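(* The image of $\xi_{\mathcal{MG}}:\operatorname{Spec}(R)\to\mathbb{B}_{\mathcal{O}}$, $R=K[\mathcal{C},\Theta]$, is an irreducible closed subscheme $\tilde X_{\mathcal{O}}$ of the border basis scheme $\mathbb{B}_{\mathcal{O}}$ that is isomorphic to an affine space over $K$ of dimension $$|\mathcal{C}|+|\Theta|=|\operatorname{LM}|\cdot|\operatorname{TM}|+|\Theta|.$$ It contains the distinguished locus $X_{\mathcal{O}}$ as a closed subscheme of dimension $|\mathcal{C}|$, and every $K$-point $[I]\in\tilde X_{\mathcal{O}}$ parametrizes an ideal $I\subseteq K[\mathbf{x}]$ that is supported at the origin of $\mathbb{A}^n_K$.
   Context: $K$ is an algebraically closed field of characteristic $0$, $K[\mathbf{x}]=K[x_1,\dots,x_n]$, $\mathbb{T}^n$ is the set of monomials in $x_1,\dots,x_n$, $\mathbb{T}^n_d$ those of degree $d$. Monomial inequalities refer to lexicographic order with $x_1>\dots>x_n$ (on monomials of arbitrary degrees). Negative degree-lexicographic listing of monomials: $m$ comes before $m'$ iff $\deg m<\deg m'$, or $\deg m=\deg m'$ and $m>m'$. Admissible order ideal: fix integers $2\le r<s$ and monomials $\mathcal{W}_d\in\mathbb{T}^n_d$ for $r\le d\le s+1$ such that $\mathcal{W}_{s+1}=x_n^{s+1}$; $x_n\mathcal{W}_d\ge\mathcal{W}_{d+1}$ for $r\le d<s$; $\mathcal{W}_s>x_n^s$. Put $\mathcal{O}=\bigcup_{d=0}^{s+1}\mathcal{O}_d$, where $\mathcal{O}_d=\mathbb{T}^n_d$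 for $d\le r-1$ and $\mathcal{O}_d=\{m\in\mathbb{T}^n_d\mid \mathcal{W}_d>m\}$ for $r\le d\le s+1$. Border: $\partial\mathcal{O}=(\bigcup_k x_k\mathcal{O})\setminus\mathcal{O}$. List $\mathcal{O}=\{t_1,\dots,t_\mu\}$ and $\partial\mathcal{O}=\{b_1,\dots,b_\nu\}$ in negative degree-lexicographic order. $\mathcal{N}=\{m\in\mathbb{T}^n\mid r\le\deg m\le s+1,\ m\notin\mathcal{O}\}\supseteq\partial\mathcal{O}$, $\mathcal{N}_{\le s}=\{m\in\mathcal{N}\mid\deg m\le s\}$; $\operatorname{LM}=\{b\in\partial\mathcal{O}\mid\deg b\le s,\ x_k\mid b\Rightarrow b/x_k\in\mathcal{O}\ \forall k\}$; $\operatorname{TM}=\mathcal{O}_s$. $\mathcal{C}=\{C_{i,j}\mid t_i\in\operatorname{TM},\ b_j\in\operatorname{LM}\}$ are indeterminates. For $m\in\mathcal{N}$ put $Y(m)=-\sum_{t_i\in\operatorname{TM}}C_{i,j}t_i$ if $m=b_j\in\operatorname{LM}$ and $Y(m)=0$ otherwise. $\operatorname{lv}(m)$ is the largest variable dividing $m$ and $\operatorname{ld}(m)$ its exponent in $m$. $x_k$ is a key variable if $x_k=\operatorname{lv}(m)$ for some $m\in\mathcal{N}_{\le s}$; then the key monomial $\chi_k$ is the lex-minimal element of $\{m'\in\operatorname{LM}\mid\operatorname{lv}(m')=x_k\}$, written $\chi_k=x_k^{e_k}\hat m_k$ with $e_k=\operatorname{ld}(\chi_k)$. Target seed monomials: $\mathcal{T}_k=\{t/\hat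 m_k\mid t\in\mathcal{O},\ \deg t\ge\deg\chi_k,\ \hat m_k\mid t,\text{ and }\chi_k\in\operatorname{LM}\Rightarrow t\notin\operatorname{TM}\}=\{t_{k,1},\dots,t_{k,\rho_k}\}$. $\Theta=\{\theta_{k,q}\mid x_k\text{ key},1\le q\le\rho_k\}$ are further indeterminates, $\sigma_k=\sum_q\theta_{k,q}t_{k,q}$, and $R=K[\mathcal{C},\Theta]$. Initial target of $m\in\mathcal{N}$: if $\deg m\le s$ and $\operatorname{lv}(m)=x_k$, then $\tau'(m)$ is $(m/x_k^{e_k})\cdot\sigma_k$ with all terms of degree $\ge s+1$ deleted (here $\operatorname{ld}(m)\ge e_k$); if $\deg m=s+1$, $\tau'(m)=0$. Targets $\tau(m)\in\operatorname{Span}_R(\mathcal{O})$, $m\in\mathcal{N}$, are defined recursively, from the last to the first element of $\mathcal{N}$ in negative degree-lexicographic order: $\tau(m)$ is obtained from $\tau'(m)$ by replacing each monomial $m'\notin\mathcal{O}$ occurring in it by $-(Y(m')+\tau(m'))$ (each such $m'$ lies in $\mathcal{N}$ and comes after $m$). $\mathcal{MG}=\{b_j+Y(b_j)+\tau(b_j)\mid b_j\in\partial\mathcal{O}\}$ is an $\mathcal{O}$-border basis: $R[\mathbf{x}]/(\mathcal{MG})$ is $R$-free with basis $\mathcal{O}$. Likewise $\mathcal{G}=\{b_j+Y(b_j)\mid b_j\in\partial\mathcal{O}\}\subseteq K[\mathcal{C}][\mathbf{x}]$ is an $\mathcal{O}$-border basis over $K[\mathcal{C}]$. Border basis scheme: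 let $c_{i,j}$ ($1\le i\le\mu$, $1\le j\le\nu$) be indeterminates and $f_j=b_j-\sum_i c_{i,j}t_i\in K[c_{i,j}][\mathbf{x}]$. For each pair $b_j,b_{j'}$ with $x_kb_j=x_\ell b_{j'}$ ($k,\ell\in\{0,\dots,n\}$, $x_0=1$, not both equal to $x_0$), the S-polynomial $x_kf_j-x_\ell f_{j'}$ is reduced to an element of $\operatorname{Span}_{K[c_{i,j}]}(\mathcal{O})$ by replacing every boundary monomial $b_q$ in it by $\sum_i c_{i,q}t_i$. $\mathcal{I}_{\mathcal{O}}$ is the ideal generated by all coefficients of these reductions, $A_{\mathcal{O}}=K[c_{i,j}]/\mathcal{I}_{\mathcal{O}}$, $\mathbb{B}_{\mathcal{O}}=\operatorname{Spec}(A_{\mathcal{O}})$; its $K$-points $[I]$ correspond to the ideals $I\subseteq K[\mathbf{x}]$ generated by $\mathcal{O}$-border bases. For a $K$-algebra $R$ and an $\mathcal{O}$-border basis $\{b_j-\sum_i z_{i,j}t_i\}\subseteq R[\mathbf{x}]$, the induced map $\operatorname{Spec}(R)\to\mathbb{B}_{\mathcal{O}}$ has comorphism $A_{\mathcal{O}}\to R$, $c_{i,j}\mapsto z_{i,j}$. $\xi_{\mathcal{MG}}$ is the map induced by $\mathcal{MG}$; the distinguished locus $X_{\mathcal{O}}$ is the image of the closed immersion $\operatorname{Spec}(K[\mathcal{C}])\to\mathbb{B}_{\mathcal{O}}$ induced by $\mathcal{G}$. *)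

(* Defs.v *)
From HB Require Import structures.
From mathcomp Require Import all_boot all_order all_algebra.
From mathcomp Require Import finmap ring_quotient.
From mathcomp Require Import boolp.
From mathcomp Require Export mpoly.

Set Implicit Arguments.
Unset Strict Implicit.
Unset Printing Implicit Defensive.

Import GRing.Theory.

Local Open Scope fset_scope.
Local Open Scope quotient_scope.
Local Open Scope ring_scope.

(* A point of [Spec A] is a [prime_idealr A]; points are compared through
   their membership predicates.  A (nonempty) closed subscheme of [Spec A] is
   given by its defining ideal [J : idealr A], with coordinate ring
   [{ideal_quot J}]; the image of a morphism of affine schemes, as a closed
   subscheme, is defined by the kernel of the comorphism. *)

Section QuotientAlgebra.
Variables (K : comNzRingType) (A : comAlgType K) (I : idealr A).
Local Notation Q := {ideal_quot I}.

Definition quot_scale (a : K) (x : Q) : Q := \pi_Q (a *: repr x).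

Lemma quot_scale_pi a x : quot_scale a (\pi_Q x) = \pi_Q (a *: x).
Proof.
apply/eqP; rewrite /quot_scale -Quotient.idealrBE -scalerBr -mulr_algl.
by rewrite idealMr // Quotient.idealrBE reprK.
Qed.

Lemma quot_scaleA a b x : quot_scale a (quot_scale b x) = quot_scale (a * b) x.
Proof.
by rewrite -[x]reprK (quot_scale_pi b) (quot_scale_pi a) quot_scale_pi scalerA.
Qed.

Lemma quot_scale1 : left_id 1 quot_scale.
Proof. by move=> x; rewrite -[x]reprK quot_scale_pi scale1r. Qed.

Lemma quot_scaleDr : right_distributive quot_scale +%R.
Proof.
by move=> a x y; rewrite -[x]reprK -[y]reprK -rmorphD !quot_scale_pi
  -rmorphD scalerDr.
Qed.

Lemma quot_scaleDl x : {morph quot_scale^~ x : a b / a + b}.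
Proof.
by move=> a b; rewrite -[x]reprK !quot_scale_pi -rmorphD scalerDl.
Qed.

HB.instance Definition _ := GRing.Zmodule_isLmodule.Build K Q
  quot_scaleA quot_scale1 quot_scaleDr quot_scaleDl.

Lemma quot_scaleAl (a : K) (x y : Q) : a *: (x * y) = a *: x * y.
Proof.
rewrite -[x]reprK -[y]reprK -rmorphM /GRing.scale /= !quot_scale_pi -rmorphM.
by rewrite scalerAl.
Qed.

HB.instance Definition _ := GRing.Lmodule_isLalgebra.Build K Q quot_scaleAl.
HB.instance Definition _ := GRing.Lalgebra_isComAlgebra.Build K Q.

End QuotientAlgebra.

Section Kernel.
Variables (A B : comNzRingType) (f : {rmorphism A -> B}).

Definition rker : {pred A} := [pred a | f a == 0].

Lemma rker_idealr_closed : idealr_closed rker.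
Proof.
split; rewrite ?inE ?rmorph0 ?rmorph1 ?oner_eq0 ?eqxx // => a u v.
by rewrite !inE => /eqP fu /eqP fv; rewrite rmorphD rmorphM fu fv mulr0 addr0.
Qed.

HB.instance Definition _ := isIdealr.Build A rker rker_idealr_closed.

Definition ker_ideal : idealr A := rker.

End Kernel.

Section Spectra.
Variable A : comNzRingType.

Definition zero_locus (S : {pred A}) (P : prime_idealr A) : Prop :=
  {subset S <= P}.

(* The closed subscheme [Spec (A/J')] lies in the closed subscheme [Spec (A/J)]. *)
Definition subscheme (J' J : idealr A) : Prop := {subset J <= J'}.

(* The image of [Spec B -> Spec A], the map [q |-> f^-1(q)] on points. *)
Definition spec_image (B : comNzRingType) (f : {rmorphism A -> B})
  (P : prime_idealr A) : Prop :=
  exists q : prime_idealr B, forall a, (a \in P) = (f a \in q).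

Definition irreducible_subset (Z : prime_idealr A -> Prop) : Prop :=
  (exists P, Z P) /\
  forall S T : {pred A},
    (forall P, Z P -> zero_locus S P \/ zero_locus T P) ->
    (forall P, Z P -> zero_locus S P) \/ (forall P, Z P -> zero_locus T P).

Definition prime_chain (d : nat) : Prop :=
  exists P : nat -> prime_idealr A, forall i, (i < d)%N ->
    {subset P i <= P i.+1} /\ ~ {subset P i.+1 <= P i}.

Definition krull_dim (d : nat) : Prop :=
  forall e, prime_chain e <-> (e <= d)%N.

Definition ideal_gen (S : A -> Prop) (a : A) : Prop :=
  exists l : seq (A * A),
    (forall q, q \in l -> S q.2) /\ a = \sum_(q <- l) q.1 * q.2.

End Spectra.

Definition is_affine_space (K : fieldType) (A : comAlgType K) (d : nat) : Prop :=
  exists f : {lrmorphism A -> {mpoly K[d]}}, bijective f.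

Notation polyring K I := {mpoly K[#|{: I}|]}.

Definition pvar (K : fieldType) (I : finType) (i : I) : polyring K I :=
  'X_(enum_rank i).

Section Border.
Variables (n : nat) (O : {fset 'X_{1..n}}).

Definition border : {fset 'X_{1..n}} :=
  [fset (U_(k) + m)%MM | k in 'I_n, m in O] `\` O.

Section Prebasis.
Variable B : comNzRingType.

Definition border_poly (c : O * border -> B) (b : border) : {mpoly B[n]} :=
  'X_[val b] - \sum_(t : O) c (t, b) *: 'X_[val t].

Definition border_reduce (c : O * border -> B) (p : {mpoly B[n]}) :
  {mpoly B[n]} :=
  \sum_(m <- msupp p)
    p@_m *: (if (insub m : option border) is Some b
             then \sum_(t : O) c (t, b) *: 'X_[val t] else 'X_[m]).

End Prebasis.

(* [None] stands for the index 0, with x_0 = 1. *)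
Definition xmon (k : option 'I_n) : 'X_{1..n} :=
  if k is Some k then U_(k)%MM else 0%MM.

Section Scheme.
Variable K : fieldType.
Local Notation Kc := (polyring K (O * border)).

Definition universal_poly : border -> {mpoly Kc[n]} :=
  border_poly (@pvar K (O * border)%type).

Definition S_poly (k l : option 'I_n) (b b' : border) : {mpoly Kc[n]} :=
  'X_[xmon k] * universal_poly b - 'X_[xmon l] * universal_poly b'.

Definition bb_generator (p : Kc) : Prop :=
  exists (k l : option 'I_n) (b b' : border) (m : 'X_{1..n}),
    [/\ ~~ ((k == None) && (l == None)),
        (xmon k + val b = xmon l + val b')%MM
      & p = (border_reduce (@pvar K (O * border)%type) (S_poly k l b b'))@_m].

Definition bb_pred : {pred Kc} := [pred p | `[< ideal_gen bb_generator p >]].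

Lemma bb_generator0 p : bb_generator p -> p.@[fun=> 0] = 0.
Proof.
case=> k [l] [b] [b'] [m] [_ kl ->].
have U0 c : map_mpoly (meval (fun=> 0)) (universal_poly c) = 'X_[val c].
  rewrite /universal_poly /border_poly rmorphB /= map_mpolyX rmorph_sum /=.
  rewrite big1 ?subr0 // => t _.
  by rewrite map_mpolyZ /= /pvar mevalXU scale0r.
have S0 c : ((S_poly k l b b')@_c).@[fun=> 0] = 0.
  rewrite -mcoeff_map_mpoly /S_poly.
  move: (U0 b) (U0 b') => /=.
  move: (universal_poly b) (universal_poly b') => u u' Uu Uu'.
  rewrite rmorphB !rmorphM /= Uu Uu'.
  by rewrite !map_mpolyX -!mpolyXD kl subrr mcoeff0.
rewrite /border_reduce raddf_sum /= rmorph_sum /= big1 // => c _.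
by rewrite mcoeffZ mevalM S0 mul0r.
Qed.

Lemma bb_idealr_closed : idealr_closed bb_pred.
Proof.
split; rewrite ?inE.
- by apply/asboolP; exists [::]; split=> //; rewrite big_nil.
- apply/asboolP=> -[l [lS /(congr1 (meval (fun=> 0)))]].
  rewrite meval1 rmorph_sum /= big_seq big1 => [/eqP|q /lS /bb_generator0 q0].
    by rewrite oner_eq0.
  by rewrite mevalM q0 mulr0.
move=> a u v; rewrite !inE => /asboolP [l [lS ->]] /asboolP [l' [lS' ->]].
apply/asboolP; exists ([seq (a * q.1, q.2) | q <- l] ++ l'); split.
  by move=> q; rewrite mem_cat => /orP [/mapP[q' /lS q'S ->]|/lS'].
rewrite big_cat big_map /= mulr_sumr; congr (_ + _).
by apply: eq_bigr => q _; rewrite mulrA.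
Qed.

HB.instance Definition _ := isIdealr.Build Kc bb_pred bb_idealr_closed.

Definition bb_ideal : idealr Kc := bb_pred.

(* The coordinate ring of the border basis scheme. *)
Definition bb_ring := {ideal_quot bb_ideal}.

HB.instance Definition _ := GRing.ComAlgebra.on bb_ring.

Definition bb_coord (ij : O * border) : bb_ring := \pi_bb_ring (pvar K ij).

(* [f] is the comorphism of the map to the border basis scheme that is induced
   by the O-border basis [g] (with [g b] the element having border monomial
   [b]): writing [g b] as [b - \sum_t z_(t,b) t], [f] maps c_(t,b) to
   z_(t,b). *)
Definition induced_comorphism (B : comNzRingType) (f : bb_ring -> B)
  (g : border -> {mpoly B[n]}) : Prop :=
  forall b, g b = border_poly (f \o bb_coord) b.

(* A K-point is a K-algebra morphism [bb_ring -> K]; it parametrizes the ideal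
   generated by the corresponding specialization of the universal polynomials. *)
Definition point_ideal (p : bb_ring -> K) : {mpoly K[n]} -> Prop :=
  ideal_gen (fun h => exists b, h = border_poly (p \o bb_coord) b).

End Scheme.
End Border.

(* The support of K[x]/I is the single point given by the maximal ideal of the
   origin. *)
Definition supported_at_origin (K : fieldType) (n : nat)
  (I : {mpoly K[n]} -> Prop) : Prop :=
  forall P : prime_idealr {mpoly K[n]},
    (forall h, I h -> h \in P) <-> (forall h, (h \in P) = (h.@[fun=> 0] == 0)).

Section MonomialOrder.
Variable n : nat.
Implicit Types m : 'X_{1..n}.

(* Lexicographic order with x_1 > ... > x_n, on monomials of any degrees
   (the library order on ['X_{1..n}] compares degrees first). *)
Definition lexgt m m' : bool :=
  [exists i : 'I_n, (m' i < m i)%N &&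
    [forall j : 'I_n, (j < i)%N ==> (m j == m' j)]].

Definition lexge m m' : bool := (m == m') || lexgt m m'.

(* Non-strict negative degree-lexicographic listing order. *)
Definition negdeglex m m' : bool :=
  (mdeg m < mdeg m')%N || ((mdeg m == mdeg m') && lexge m m').

Definition monos_upto (d : nat) : {fset 'X_{1..n}} :=
  [fset bmnm m | m : 'X_{1..n < d.+1}].

(* x_n^e; the last variable has index n.-1. *)
Definition xlast (e : nat) : 'X_{1..n} := [multinom (e * (i.+1 == n))%N | i < n].

(* The largest variable dividing m is the one with the smallest index. *)
Definition lv m : option 'I_n :=
  [pick k : 'I_n | (0 < m k)%N && [forall j : 'I_n, (j < k)%N ==> (m j == 0%N)]].

End MonomialOrder.

Section Admissible.
Variables (n r s : nat) (W : nat -> 'X_{1..n}).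

Definition admissible : Prop :=
  [/\ (2 <= r)%N /\ (r < s)%N,
      forall d, (r <= d <= s.+1)%N -> mdeg (W d) = d,
      W s.+1 = xlast n s.+1,
      forall d, (r <= d < s)%N -> lexge (xlast n 1 + W d)%MM (W d.+1)
    & lexgt (W s) (xlast n s)].

Definition order_ideal : {fset 'X_{1..n}} :=
  [fset m in monos_upto n s.+1 |
    (mdeg m < r)%N || (r <= mdeg m)%N && lexgt (W (mdeg m)) m].

Local Notation O := order_ideal.

Definition nonO : {fset 'X_{1..n}} :=
  [fset m in monos_upto n s.+1 | (r <= mdeg m)%N && (m \notin O)].

Definition nonO_le : {fset 'X_{1..n}} := [fset m in nonO | (mdeg m <= s)%N].

Definition LM : {fset 'X_{1..n}} :=
  [fset b in border O | (mdeg b <= s)%N &&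
    [forall k : 'I_n, (0 < b k)%N ==> ((b - U_(k))%MM \in O)]].

Definition TM : {fset 'X_{1..n}} := [fset t in O | mdeg t == s].

Definition key (k : 'I_n) : bool :=
  [exists m : nonO_le, lv (val m) == Some k].

(* Only used when x_k is a key variable, where the [pick] succeeds. *)
Definition key_monomial (k : 'I_n) : 'X_{1..n} :=
  if [pick b : LM | (lv (val b) == Some k) &&
        [forall b' : LM, (lv (val b') == Some k) ==> lexge (val b') (val b)]]
  is Some b then val b else 0%MM.

Definition key_exp (k : 'I_n) : nat := key_monomial k k.

Definition key_cofactor (k : 'I_n) : 'X_{1..n} :=
  (key_monomial k - U_(k) *+ key_exp k)%MM.

Definition seeds (k : 'I_n) : {fset 'X_{1..n}} :=
  [fset (t - key_cofactor k)%MM | t in O &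
    [&& (mdeg (key_monomial k) <= mdeg t)%N, (key_cofactor k <= t)%MM
      & (key_monomial k \in LM) ==> (t \notin TM)]].

Definition Theta : {fset 'I_n * 'X_{1..n}} :=
  [fset ((k, u) : 'I_n * 'X_{1..n}) |
    k in [fset k in 'I_n | key k], u in seeds k].

(* The indeterminates C_(t,b) and theta_(k,u) are indexed by the monomials
   themselves rather than by their positions in the listings. *)
Definition C_index : finType := (TM * LM)%type.
Definition CTheta_index : finType := (C_index + Theta)%type.

Section Y.
Variables (B : comNzRingType) (C : C_index -> B).

Definition Ypoly (m : 'X_{1..n}) : {mpoly B[n]} :=
  if (insub m : option LM) is Some b
  then - \sum_(t : TM) C (t, b) *: 'X_[val t] else 0.

End Y.

Variable K : fieldType.

Definition KC := polyring K C_index.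
Definition KCTheta := polyring K CTheta_index.
HB.instance Definition _ := GRing.ComAlgebra.on KC.
HB.instance Definition _ := GRing.ComAlgebra.on KCTheta.

Definition Cvar (ij : C_index) : KCTheta := pvar K (inl ij : CTheta_index).
Definition Tvar (kq : Theta) : KCTheta := pvar K (inr kq : CTheta_index).

Definition sigma (k : 'I_n) : {mpoly KCTheta[n]} :=
  \sum_(kq : Theta | (val kq).1 == k) Tvar kq *: 'X_[(val kq).2].

Definition trunc (d : nat) (p : {mpoly KCTheta[n]}) : {mpoly KCTheta[n]} :=
  \sum_(m <- msupp p | (mdeg m <= d)%N) p@_m *: 'X_[m].

Definition initial_target (m : 'X_{1..n}) : {mpoly KCTheta[n]} :=
  if (mdeg m <= s)%N then
    if lv m is Some k
    then trunc s ('X_[(m - U_(k) *+ key_exp k)%MM] * sigma k) else 0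
  else 0.

Definition replace_nonO (tau : 'X_{1..n} -> {mpoly KCTheta[n]})
  (p : {mpoly KCTheta[n]}) : {mpoly KCTheta[n]} :=
  \sum_(m <- msupp p)
    p@_m *: (if m \in O then 'X_[m] else - (Ypoly Cvar m + tau m)).

(* [foldr] processes the listing of N from its last to its first element. *)
Definition target : 'X_{1..n} -> {mpoly KCTheta[n]} :=
  foldr (fun m tau m' => if m' == m then replace_nonO tau (initial_target m)
                         else tau m')
        (fun=> 0) (sort (@negdeglex n) (enum_fset nonO)).

Definition MG (b : border O) : {mpoly KCTheta[n]} :=
  'X_[val b] + Ypoly Cvar (val b) + target (val b).

Definition G (b : border O) : {mpoly KC[n]} :=
  'X_[val b] + Ypoly (@pvar K C_index) (val b).

End Admissible.

(* Main.v *)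
(* Let NF be the linear map fixing O, sending m outside O to -(Y(m) + tau(m)) and
   killing all degrees above s.  Since the targets are obtained by reducing
   (m/x_k^(e_k)) sigma_k, one shows by induction from the end of the listing that
   NF (x_j NF m) = NF (x_j m), so the kernel of NF is an ideal containing MG; the
   reduced S-polynomials of MG lie in this kernel and in the span of O, hence
   vanish, and MG defines a comorphism.

   It is surjective, hence a closed immersion of affine space: the target of the
   key monomial chi_k is mhat_k sigma_k, which exhibits the theta_(k,q), and then
   the C_(i,j) are recovered by induction from the end of the listing.  Setting
   Theta = 0 turns MG into G.

   A chain of primes in K[x_1..x_d] of length d + 1 is excluded by choosing x_i in
   P_(i+1) outside P_i and peeling off an algebraic relation between x_0, .., x_d
   along its lexicographically smallest term.

   A point of the locus has coefficients c_(t,b) = 0 whenever deg t < deg b.  If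
   x_(k+1), .., x_n lie in a prime P over I and x_k^e is the smallest power of x_k
   outside O, then every t in O of degree at least e involves one of these
   variables, so x_k^e and thus x_k lie in P. *)

Require Import Defs.
From HB Require Import structures.
From mathcomp Require Import all_boot all_order all_algebra.
From mathcomp Require Import finmap ring_quotient.
From mathcomp Require Import boolp zify.

Set Implicit Arguments.
Unset Strict Implicit.
Unset Printing Implicit Defensive.

Import GRing.Theory.

Local Open Scope fset_scope.
Local Open Scope quotient_scope.
Local Open Scope ring_scope.

(** * Lexicographic order and linear extensions *)

Section LexOrder.
Variable n : nat.
Implicit Types m u : 'X_{1..n}.

Lemma lexgtP m m' : reflect
  (exists2 i, (m' i < m i)%N & forall j : 'I_n, (j < i)%N -> m j = m' j)
  (lexgt m m').
Proof.
apply: (iffP existsP) => [[i /andP[lt_i /forallP eq_i]]|[i lt_i eq_i]].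
  by exists i => // j ji; apply/eqP/(implyP (eq_i j)).
by exists i; rewrite lt_i; apply/forallP => j; apply/implyP => /eq_i ->.
Qed.

Lemma lexgt_irr m : lexgt m m = false.
Proof. by apply/lexgtP => -[i]; rewrite ltnn. Qed.

Lemma lexgt_trans m2 m1 m3 : lexgt m1 m2 -> lexgt m2 m3 -> lexgt m1 m3.
Proof.
move=> /lexgtP[i lti eqi] /lexgtP[j ltj eqj]; apply/lexgtP.
case: (ltngtP i j) => [ij|ji|/val_inj ij].
- by exists i; [rewrite -(eqj _ ij)|move=> k ki; rewrite eqi // eqj //; lia].
- by exists j; [rewrite (eqi _ ji)|move=> k kj; rewrite -eqj // eqi //; lia].
by exists i; [rewrite ij in lti *; lia|move=> k ki; rewrite eqi // eqj -?ij].
Qed.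

Lemma lexgt_total m m' : m != m' -> lexgt m m' || lexgt m' m.
Proof.
move=> neq; have /existsP ex : [exists i, m i != m' i].
  apply: contraR neq => /existsPn eqm; apply/eqP/mnmP => i.
  by have := eqm i; rewrite negbK => /eqP.
case: ex => i0 i0P; case: (@arg_minnP _ i0 (fun i => m i != m' i) (fun i : 'I_n => i : nat) i0P)
  => i neqi mini.
have eqi (j : 'I_n) : (j < i)%N -> m j = m' j.
  by move=> ji; apply/eqP; apply/negP => /negP /mini; rewrite leqNgt ji.
case: (ltngtP (m i) (m' i)) neqi => // lti _.
  by apply/orP; right; apply/lexgtP; exists i => // j /eqi.
by apply/orP; left; apply/lexgtP; exists i.
Qed.

Lemma lexgt_asym m m' : lexgt m m' -> ~~ lexgt m' m.
Proof. by move=> h; apply/negP => /(lexgt_trans h); rewrite lexgt_irr. Qed.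

Lemma lexgeN m m' : lexge m m' = ~~ lexgt m' m.
Proof.
rewrite /lexge; case: eqVneq => [->|/lexgt_total] /=; first by rewrite lexgt_irr.
by case: (boolP (lexgt m' m)) => [/lexgt_asym/negPf-> //|_ /orP[]].
Qed.

Lemma lexge_refl m : lexge m m.
Proof. by rewrite /lexge eqxx. Qed.

Lemma lexge_gt_trans m2 m1 m3 : lexge m1 m2 -> lexgt m2 m3 -> lexgt m1 m3.
Proof. by move=> /orP[/eqP->//|]; apply: lexgt_trans. Qed.

Lemma lexge_trans m2 m1 m3 : lexge m1 m2 -> lexge m2 m3 -> lexge m1 m3.
Proof.
move=> h /orP[/eqP<-//|h']; apply/orP; right; exact: lexge_gt_trans h h'.
Qed.

Lemma lexgt_add2r u m m' : lexgt (m + u)%MM (m' + u)%MM = lexgt m m'.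
Proof.
apply/lexgtP/lexgtP => -[i lti eqi]; exists i => [|j /eqi];
  move: lti; rewrite ?mnmDE; lia.
Qed.

Lemma lexge_add2r u m m' : lexge (m + u)%MM (m' + u)%MM = lexge m m'.
Proof. by rewrite !lexgeN lexgt_add2r. Qed.

Lemma lexge_add m1 m2 u1 u2 :
  lexge m1 u1 -> lexge m2 u2 -> lexge (m1 + m2)%MM (u1 + u2)%MM.
Proof.
move=> h1 h2; apply: (@lexge_trans (u1 + m2)%MM); first by rewrite lexge_add2r.
by rewrite ![(u1 + _)%MM]addmC lexge_add2r.
Qed.

Definition listed_before m m' : bool :=
  (mdeg m < mdeg m')%N || (mdeg m == mdeg m') && lexgt m m'.

Lemma listed_before_irr m : listed_before m m = false.
Proof. by rewrite /listed_before lexgt_irr ltnn andbF. Qed.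

Lemma listed_before_trans m2 m1 m3 :
  listed_before m1 m2 -> listed_before m2 m3 -> listed_before m1 m3.
Proof.
rewrite /listed_before.
move=> /orP[h1|/andP[/eqP e1 l1]] /orP[h2|/andP[/eqP e2 l2]].
- by rewrite (ltn_trans h1 h2).
- by rewrite -e2 h1.
- by rewrite e1 h2.
by rewrite e1 e2 eqxx (lexgt_trans l1 l2) orbT.
Qed.

Lemma listed_before_add2r u m m' :
  listed_before (m + u)%MM (m' + u)%MM = listed_before m m'.
Proof. by rewrite /listed_before !mdegD ltn_add2r eqn_add2r lexgt_add2r. Qed.

Lemma listed_before_deg m m' : listed_before m m' -> (mdeg m <= mdeg m')%N.
Proof. by move=> /orP[/ltnW|/andP[/eqP->]]. Qed.

Lemma negdeglexE m m' : negdeglex m m' = (m == m') || listed_before m m'.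
Proof.
rewrite /negdeglex /listed_before /lexge.
by case: (eqVneq m m') => [->|]; first by rewrite eqxx orbT.
Qed.

Lemma negdeglex_total : total (@negdeglex n).
Proof.
move=> m m'; rewrite !negdeglexE /listed_before.
have [//|/lexgt_total] := eqVneq m m'.
by case: (ltngtP (mdeg m) (mdeg m')); rewrite ?orbT // => _; do 2 case: lexgt;
  rewrite ?orbT.
Qed.

Lemma negdeglex_trans : transitive (@negdeglex n).
Proof.
move=> m2 m1 m3; rewrite !negdeglexE => /orP[/eqP->//|h1] /orP[/eqP<-|h2].
  by rewrite h1 orbT.
by rewrite (listed_before_trans h1 h2) orbT.
Qed.

(** Induction from the end of the listing: only finitely many monomials have degree at most [d], so
    the set of those listed after [m] shrinks strictly. *)
Lemma listed_ind (d : nat) (P : 'X_{1..n} -> Prop) :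
  (forall m, (mdeg m <= d)%N ->
     (forall m', (mdeg m' <= d)%N -> listed_before m m' -> P m') -> P m) ->
  forall m, (mdeg m <= d)%N -> P m.
Proof.
move=> step m.
have [k] := ubnP #|[set x : 'X_{1..n < d.+1} | listed_before m x]|.
elim: k m => // k IHk m lek md; apply: step => // m' m'd mm'.
apply: IHk => //; apply: leq_trans (_ : _ <= #|[set x : 'X_{1..n < d.+1} |
  listed_before m x]|)%N _; last by [].
have m'd1 : (mdeg m' < d.+1)%N by [].
apply/proper_card/properP; split.
  by apply/subsetP => x; rewrite !inE; apply: listed_before_trans.
by exists (BMultinom m'd1); rewrite !inE //= listed_before_irr.
Qed.

Lemma lvP m k :
  reflect ((0 < m k)%N /\ forall j : 'I_n, (j < k)%N -> m j = 0%N)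
          (lv m == Some k).
Proof.
rewrite /lv; case: pickP => [l /andP[ml /forallP l0]|no].
  apply: (iffP eqP) => [[<-]|[mk k0]].
    by split=> // j jl; apply/eqP/(implyP (l0 j)).
  congr Some; apply/val_inj; case: (ltngtP l k) => // h.
    by rewrite (k0 _ h) in ml.
  by have := implyP (l0 k) h; rewrite eqn0Ngt mk.
apply: (iffP eqP) => // -[mk k0].
have := no k; rewrite mk /= => /negbT /forallPn [j]; rewrite negb_imply.
by move=> /andP[jk]; rewrite (k0 _ jk).
Qed.

Lemma lv_exists m : (0 < mdeg m)%N -> exists k, lv m = Some k.
Proof.
move=> md; have /existsP[i0 i0P] : [exists i, (0 < m i)%N].
  apply: contraTT md => /existsPn m0.
  rewrite -eqn0Ngt mdeg_eq0; apply/eqP/mnmP => i; rewrite mnm0E.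
  by have := m0 i; lia.
case: (@arg_minnP _ i0 (fun i => 0 < m i)%N (fun i : 'I_n => i : nat) i0P)
  => i mi mini.
exists i; apply/eqP/lvP; split=> // j ji.
by apply/eqP; rewrite eqn0Ngt; apply/negP => /mini; rewrite leqNgt ji.
Qed.

Lemma lexge_min_exists (T : eqType) (f : T -> 'X_{1..n}) (s : seq T) x :
  x \in s -> exists2 y, y \in s & forall z, z \in s -> lexge (f z) (f y).
Proof.
elim: s x => // a s IHs x _; case: s IHs => [|b s] IHs.
  by exists a; rewrite ?inE // => z; rewrite inE => /eqP->; apply: lexge_refl.
have [y ys miny] := IHs b (mem_head _ _).
case: (boolP (lexge (f a) (f y))) => h.
  exists y => [|z]; first by rewrite in_cons ys orbT.
  by rewrite in_cons => /orP[/eqP->|/miny].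
exists a; rewrite ?mem_head // => z; rewrite in_cons.
move=> /orP[/eqP->|/miny zy]; first exact: lexge_refl.
apply: lexge_trans zy _; move: h; rewrite lexgeN negbK => h.
by rewrite /lexge h orbT.
Qed.

End LexOrder.

Section LinearExtension.
Variables (n : nat) (B : comNzRingType).
Implicit Types (phi psi : 'X_{1..n} -> {mpoly B[n]}) (p q : {mpoly B[n]}).

(** [border_reduce] and [replace_nonO] have exactly this shape and [trunc] can be brought to it, so
    identities between them reduce to single monomials by linearity. *)
Definition mlin phi p : {mpoly B[n]} := \sum_(m <- msupp p) p@_m *: phi m.

Lemma mlin_widen phi p (L : seq 'X_{1..n}) : uniq L ->
  {subset msupp p <= L} -> mlin phi p = \sum_(m <- L) p@_m *: phi m.
Proof.
move=> uL sub; rewrite (bigID (mem (msupp p))) /= [X in _ = _ + X]big1.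
  rewrite addr0 -[RHS]big_filter; apply: perm_big; apply: uniq_perm.
  - exact: msupp_uniq.
  - exact: filter_uniq.
  by move=> m; rewrite mem_filter; case: (boolP (m \in msupp p)) => //= /sub ->.
by move=> m /memN_msupp_eq0 ->; rewrite scale0r.
Qed.

Lemma mlin_is_linear phi : linear (mlin phi).
Proof.
move=> a p q; pose L := undup (msupp (a *: p + q) ++ msupp p ++ msupp q).
rewrite !(@mlin_widen phi _ L) ?undup_uniq //; first last.
- by move=> m mp; rewrite mem_undup !mem_cat mp.
- by move=> m mp; rewrite mem_undup !mem_cat mp orbT.
- by move=> m mp; rewrite mem_undup !mem_cat mp !orbT.
rewrite scaler_sumr -big_split /=; apply: eq_bigr => m _.
by rewrite mcoeffD mcoeffZ scalerDl scalerA.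
Qed.

HB.instance Definition _ phi :=
  GRing.isLinear.Build B {mpoly B[n]} {mpoly B[n]} *:%R (mlin phi)
    (mlin_is_linear phi).

Lemma mlinX phi m : mlin phi 'X_[m] = phi m.
Proof. by rewrite /mlin msuppX big_seq1 mcoeffX eqxx scale1r. Qed.

Lemma eq_mlin_supp phi psi p : {in msupp p, phi =1 psi} ->
  mlin phi p = mlin psi p.
Proof. by move=> eqp; apply: eq_big_seq => m /eqp ->. Qed.

Lemma mlin_id p : mlin (fun m => 'X_[m]) p = p.
Proof. by rewrite [RHS]mpolyE. Qed.

Lemma mlinE (L : {linear {mpoly B[n]} -> {mpoly B[n]}}) p :
  L p = mlin (fun m => L 'X_[m]) p.
Proof. by rewrite {1}[p]mpolyE linear_sum; apply: eq_bigr => m _; rewrite linearZ. Qed.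

Lemma eq_linear_supp (L L' : {linear {mpoly B[n]} -> {mpoly B[n]}}) p :
  (forall m, m \in msupp p -> L 'X_[m] = L' 'X_[m]) -> L p = L' p.
Proof. by move=> eqL; rewrite (mlinE L) (mlinE L'); apply: eq_mlin_supp. Qed.

End LinearExtension.

(** * The order ideal and its key monomials *)

Section PurePowers.
Variable n : nat.
Implicit Types m : 'X_{1..n.+1}.

Lemma xlastE e : xlast n.+1 e = (U_(ord_max) *+ e)%MM.
Proof.
apply/mnmP => i; rewrite mnmE mulmnE mnm1E mulnC eqSS; congr (_ * _)%N.
by rewrite -val_eqE /= eq_sym.
Qed.

Lemma lexge_pure_power (k : 'I_n.+1) m : (forall j : 'I_n.+1, (k < j)%N -> m j = 0%N) ->
  lexge m (U_(k) *+ mdeg m)%MM.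
Proof.
move=> mk; rewrite lexgeN; apply/lexgtP => -[i]; rewrite mulmnE mnm1E.
case: eqP => [<-|]; last by rewrite mul0n.
rewrite mul1n => lt_m eq_m.
have m0 (j : 'I_n.+1) : j != k -> m j = 0%N.
  case: (ltngtP j k) => [jk _|/mk-> //|/val_inj->]; last by rewrite eqxx.
  rewrite -(eq_m _ jk) mulmnE mnm1E -val_eqE /=.
  by case: eqP jk => // ->; rewrite ltnn.
by move: lt_m; rewrite mdegE (bigD1 k) //= big1 ?addn0 ?ltnn // => j /m0.
Qed.

Lemma lexge_xlast m : lexge m (U_(ord_max) *+ mdeg m)%MM.
Proof.
by apply: lexge_pure_power => j; rewrite ltnNge -ltnS ltn_ord.
Qed.

End PurePowers.

Section OrderIdeal.
Variables (n' r s : nat) (W : nat -> 'X_{1..n'.+1}).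
Hypothesis hW : admissible r s W.
Local Notation n := n'.+1.
Local Notation O := (order_ideal r s W).
Local Notation xn := (@ord_max n').
Implicit Types m t u w b : 'X_{1..n}.

Lemma admissible_bounds : (2 <= r)%N /\ (r < s)%N.
Proof. by case: hW. Qed.

Lemma mem_monos_upto d m : (m \in monos_upto n d) = (mdeg m <= d)%N.
Proof.
apply/imfsetP/idP => [[x _ ->]|md]; first by rewrite -ltnS bmdeg.
have md1 : (mdeg m < d.+1)%N by [].
by exists (BMultinom md1).
Qed.

(** Degrees stop at [s] because in degree [s+1] the bound is [x_n^(s+1)], the smallest monomial of
    its degree. *)
Lemma mem_order_ideal m : (m \in O) =
  (mdeg m <= s)%N && ((mdeg m < r)%N || lexgt (W (mdeg m)) m).
Proof.
have [r2 rs] := admissible_bounds.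
have -> : (m \in O) = (mdeg m <= s.+1)%N &&
   ((mdeg m < r)%N || (r <= mdeg m)%N && lexgt (W (mdeg m)) m).
  by rewrite !inE /= mem_monos_upto.
case: (ltngtP (mdeg m) s.+1) => [||md]; rewrite ?ltnS.
- by move=> ->; case: ltnP.
- by move=> h; rewrite [(_ <= s)%N]leqNgt (ltnW h).
rewrite md ltnn leqNgt; case: hW => _ _ -> _ _; rewrite xlastE -md.
by have := lexge_xlast m; rewrite lexgeN => /negPf ->; rewrite andbF; lia.
Qed.

Lemma order_ideal_deg m : m \in O -> (mdeg m <= s)%N.
Proof. by rewrite mem_order_ideal => /andP[]. Qed.

Lemma low_deg_order_ideal m : (mdeg m < r)%N -> m \in O.
Proof. by have := admissible_bounds; rewrite mem_order_ideal; lia. Qed.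

Lemma mem_nonO m : (m \in nonO r s W) = (m \notin O) && (mdeg m <= s.+1)%N.
Proof.
have -> : (m \in nonO r s W) = (mdeg m <= s.+1)%N && ((r <= mdeg m)%N && (m \notin O)).
  by rewrite in_fset inE /= mem_monos_upto.
case: (boolP (m \in O)) => mO; rewrite ?andbF //= !andbT andbC.
case: (ltnP (mdeg m) r) => // /low_deg_order_ideal.
by rewrite (negPf mO).
Qed.

Lemma W_mono d e : (r <= d)%N -> (d + e <= s.+1)%N ->
  lexge (W d + U_(xn) *+ e)%MM (W (d + e)).
Proof.
case: hW => _ degW W1 Wstep _ rd; elim: e => [|e IHe] des.
  by rewrite addn0 addm0 lexge_refl.
apply: (@lexge_trans _ (W (d + e) + U_(xn))%MM).
  by rewrite mulmSr addmA lexge_add2r IHe //; lia.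
(* The passage from degree [s] to [s+1] is not among the growth conditions on [W]; it holds because
   [x_n^(s+1)] is smallest in its degree. *)
rewrite addnS; have [deS|deS] : (d + e < s)%N \/ (d + e = s)%N by lia.
  have := Wstep (d + e)%N; rewrite xlastE mulm1n addmC; apply; lia.
rewrite deS W1 xlastE.
have -> : s.+1 = mdeg (W s + U_(xn)) by rewrite mdegD mdeg1 degW; lia.
exact: lexge_xlast.
Qed.

(** Along [W_mono], [m >= W_(deg m)] becomes [m x_n^e >= W_(deg m + e)]. Closure of [O] under
    divisors and its being a lex segment in each degree are both instances. *)
Lemma nonO_dom m m' : m \notin O -> (mdeg m <= mdeg m')%N ->
  lexge m' (m + U_(xn) *+ (mdeg m' - mdeg m))%MM -> m' \notin O.
Proof.
move=> mO dd mle; apply/negP; rewrite mem_order_ideal => /andP[m's].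
have rm : (r <= mdeg m)%N.
  by rewrite leqNgt; apply: contra mO; apply: low_deg_order_ideal.
have mW : lexge m (W (mdeg m)).
  by move: mO; rewrite mem_order_ideal lexgeN; apply: contra => ->; lia.
case/orP => [|]; first lia.
apply/negP; rewrite -lexgeN; apply: lexge_trans mle _.
have := @W_mono (mdeg m) (mdeg m' - mdeg m); rewrite subnKC // => Wm.
by apply: lexge_trans (Wm _ _); [rewrite lexge_add2r|lia|lia].
Qed.

Lemma nonO_mul m u : m \notin O -> (m + u)%MM \notin O.
Proof.
move=> mO; apply: nonO_dom mO _ _; first by rewrite mdegD leq_addr.
rewrite mdegD addKn; apply: lexge_add; [exact: lexge_refl|exact: lexge_xlast].
Qed.

Lemma order_ideal_div m u : (m + u)%MM \in O -> m \in O.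
Proof. by apply: contraLR; apply: nonO_mul. Qed.

Lemma nonO_lex m m' : m \notin O -> mdeg m' = mdeg m -> lexge m' m -> m' \notin O.
Proof.
by move=> mO dd mm'; apply: nonO_dom mO _ _; rewrite dd // subnn addm0.
Qed.

Lemma nonO_deg m : m \notin O -> (1 < mdeg m)%N.
Proof.
have := admissible_bounds => -[r2 _]; rewrite ltnNge; apply: contra => h.
by apply: low_deg_order_ideal; lia.
Qed.

Lemma xlast_in i : (i <= s)%N -> (U_(xn) *+ i)%MM \in O.
Proof.
move=> si; apply: (@order_ideal_div _ (U_(xn) *+ (s - i))%MM).
have -> : (U_(xn) *+ i + U_(xn) *+ (s - i) = U_(xn) *+ s)%MM.
  by apply/mnmP => j; rewrite mnmDE !mulmnE -mulnDr subnKC.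
rewrite mem_order_ideal mdegMn mdeg1 mul1n leqnn; case: hW => _ _ _ _.
by rewrite xlastE => ->; rewrite orbT.
Qed.

Lemma mem_border b : reflect (b \notin O /\ exists k m, m \in O /\ b = (U_(k) + m)%MM)
  (b \in border O).
Proof.
rewrite in_fsetD; apply: (iffP andP) => [[bO]|[bO [k [m [mO bE]]]]].
  by case/imfset2P => k _ [m mO bE]; split=> //; exists k; exists m.
by split=> //; apply/imfset2P; exists k => //; exists m.
Qed.

Lemma subU_add (k : 'I_n) b : (0 < b k)%N -> (U_(k) + (b - U_(k)) = b)%MM.
Proof. by move=> bk; rewrite addmC submK // lep1mP; lia. Qed.

Lemma mem_LM b : reflect [/\ b \notin O, (mdeg b <= s)%N &
   forall k, (0 < b k)%N -> (b - U_(k))%MM \in O] (b \in LM r s W).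
Proof.
have -> : (b \in LM r s W) = [&& b \in border O, (mdeg b <= s)%N &
    [forall k : 'I_n, (0 < b k)%N ==> ((b - U_(k))%MM \in O)]].
  by rewrite in_fset inE.
apply: (iffP and3P) => [[/mem_border[bO _] bs /forallP h]|[bO bs h]].
  by split=> // k; apply/implyP.
split=> //; last by apply/forallP => k; apply/implyP/h.
apply/mem_border; split=> //.
have [|k /eqP/lvP[bk _]] := @lv_exists _ b; first exact: ltnW (nonO_deg bO).
by exists k, (b - U_(k))%MM; rewrite h // subU_add.
Qed.

(** Divide by variables while the quotient stays outside [O]; where this stops, all quotients lie in
    [O]. *)
Lemma LM_divisor m : m \notin O -> (mdeg m <= s)%N ->
  exists2 b, b \in LM r s W & (b <= m)%MM.
Proof.
have [k] := ubnP (mdeg m); elim: k m => // k IHk m mk mO ms.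
have [/existsP[i /andP[mi miO]]|/existsPn no] :=
  boolP [exists i, (0 < m i)%N && ((m - U_(i))%MM \notin O)].
  have dm : mdeg m = (mdeg (m - U_(i))%MM).+1.
    by rewrite -{1}(subU_add mi) mdegD mdeg1.
  have [||b bLM bm] := IHk _ _ miO; [lia|lia|].
  by exists b => //; apply: lepm_trans bm (lem_subr _ _).
exists m; last exact: lepm_refl.
apply/mem_LM; split=> // i mi; have := no i.
by rewrite mi /= negbK.
Qed.

Lemma lv_small m (k : 'I_n) : lv m = Some k -> m \notin O -> (mdeg m <= s)%N ->
  (k < n')%N.
Proof.
move=> /eqP/lvP[mk m0] mO ms; rewrite ltnNge; apply/negP => nk.
move/negP: mO; apply; have -> : m = (U_(xn) *+ m xn)%MM.
  apply/mnmP => j; rewrite mulmnE mnm1E; case: eqP => [<-|/eqP jn]; rewrite ?mul1n //.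
  rewrite mul0n m0 //; have := ltn_ord j; move: jn; rewrite -val_eqE /=; lia.
by apply: xlast_in; apply: leq_trans ms; rewrite mdegE (bigD1 xn) //= leq_addr.
Qed.

(** For the least [j] with [x_k x_n^j] outside [O], the possible quotients [x_n^j] and
    [x_k x_n^(j-1)] both lie in [O]. *)
Lemma LM_two_variables (k : 'I_n) i : (k < n')%N -> (i < s)%N ->
  (U_(k) + U_(xn) *+ i)%MM \notin O ->
  exists2 j, (j <= i)%N & (U_(k) + U_(xn) *+ j)%MM \in LM r s W.
Proof.
move=> kn; elim: i => [|i IHi] si.
  by rewrite mulm0n addm0 => /nonO_deg; rewrite mdeg1.
move=> iO'; have [iO|iO] := boolP ((U_(k) + U_(xn) *+ i)%MM \in O); last first.
  by have [|j ji jLM] := IHi _ iO; [lia|exists j => //; lia].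
exists i.+1 => //; apply/mem_LM; split=> // [|j].
  by rewrite mdegD mdegMn !mdeg1 mul1n.
rewrite mnmDE mulmnE !mnm1E; case: (eqVneq k j) => [<- _|kj].
  by rewrite addmC addmK xlast_in //; lia.
case: (eqVneq xn j) => [<- _|]; last by rewrite mul0n.
by rewrite mulmSr addmA addmK.
Qed.

(** If a divisor [b] of [m] in [LM] misses [x_k], it involves only smaller variables. Then
    [x_k x_n^(deg b - 1)] is lex larger than [b] in the same degree, hence outside [O], and yields
    an element of [LM] with exponent 1 at [x_k]. *)
Lemma lv_LM_divisor m (k : 'I_n) : m \notin O -> (mdeg m <= s)%N -> lv m = Some k ->
  exists b, [/\ b \in LM r s W, lv b = Some k & (b k <= m k)%N].
Proof.
move=> mO ms lvm; have kn := lv_small lvm mO ms.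
move/eqP/lvP: lvm => [mk m0].
have [b bLM /mnm_lepP bm] := LM_divisor mO ms.
case: (posnP (b k)) => bk; last first.
  exists b; split=> //; apply/eqP/lvP; split=> // j /m0 mj.
  by have := bm j; rewrite mj; lia.
have [bO bs _] := mem_LM _ bLM.
have [||j _ jLM] := @LM_two_variables k (mdeg b).-1 kn; have b1 := nonO_deg bO.
- lia.
- have db : mdeg (U_(k) + U_(xn) *+ (mdeg b).-1)%MM = mdeg b.
    by rewrite mdegD mdegMn !mdeg1; lia.
  apply: nonO_lex bO db _; apply/orP; right; apply/lexgtP; exists k.
    by rewrite bk mnmDE mnm1E eqxx.
  move=> j jk; have := bm j; rewrite (m0 _ jk) mnmDE mulmnE !mnm1E -!val_eqE /=.
  by do 2 (case: eqP; try lia).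
have e1 : (U_(k) + U_(xn) *+ j)%MM k = 1%N.
  by rewrite mnmDE mulmnE !mnm1E eqxx -val_eqE /=; case: eqP; lia.
exists (U_(k) + U_(xn) *+ j)%MM; rewrite e1; split=> //.
apply/eqP/lvP; rewrite e1; split=> // i ik.
rewrite mnmDE mulmnE !mnm1E -!val_eqE /=; have := ltn_ord i.
by do 2 (case: eqP; try lia).
Qed.

End OrderIdeal.

Section Keys.
Variables (n' r s : nat) (W : nat -> 'X_{1..n'.+1}).
Hypothesis hW : admissible r s W.
Local Notation n := n'.+1.
Local Notation O := (order_ideal r s W).
Local Notation xn := (@ord_max n').
Local Notation chi := (key_monomial r s W).
Local Notation mhat := (key_cofactor r s W).
Implicit Types m t u w b : 'X_{1..n}.

Lemma key_monomialP k b : b \in LM r s W -> lv b = Some k ->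
  [/\ chi k \in LM r s W, lv (chi k) = Some k &
      forall b', b' \in LM r s W -> lv b' = Some k -> lexge b' (chi k)].
Proof.
move=> bLM lvb; rewrite /key_monomial; case: pickP => [c|no].
  move=> /andP[/eqP lvc /forallP minc]; split=> // [|b' b'LM lvb'].
    exact: valP.
  by apply: (implyP (minc [` b'LM])); rewrite /= lvb'.
have : b \in [seq c <- LM r s W | lv c == Some k] by rewrite mem_filter lvb eqxx.
case/(lexge_min_exists id) => c; rewrite mem_filter => /andP[/eqP lvc cLM] minc.
have /negP[] := negbT (no [` cLM]); rewrite /= lvc eqxx /=.
apply/forallP => b'; apply/implyP => lvb'; apply: minc.
by rewrite mem_filter lvb' (valP b').
Qed.

(** Among monomials with leading variable [x_k] the lex comparison starts at the exponent of [x_k],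
    so the lex-minimal one has the least exponent. Hence [m / x_k^(e_k)] is a genuine monomial. *)
Lemma key_monomial_spec m k : m \notin O -> (mdeg m <= s)%N -> lv m = Some k ->
  [/\ chi k \in LM r s W, lv (chi k) = Some k & (chi k k <= m k)%N].
Proof.
move=> mO ms lvm; have [b [bLM lvb bm]] := lv_LM_divisor hW mO ms lvm.
have [cLM lvc minc] := key_monomialP bLM lvb; split=> //.
apply: leq_trans bm; rewrite leqNgt; apply/negP => cb.
have := minc _ bLM lvb; rewrite lexgeN => /negP; apply.
apply/lexgtP; exists k => // j jk.
by case/eqP/lvP: lvc => _ ->//; case/eqP/lvP: lvb => _ ->.
Qed.

Lemma key_cofactorK k : (mhat k + U_(k) *+ chi k k)%MM = chi k.
Proof.
rewrite submK //; apply/mnm_lepP => j; rewrite mulmnE mnm1E.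
by case: eqP => [->|]; rewrite ?mul1n ?mul0n.
Qed.

Lemma mem_seeds k u : chi k \in LM r s W -> u \in seeds r s W k ->
  [/\ (u + mhat k)%MM \in O, (mdeg (chi k) <= mdeg (u + mhat k)%MM)%N &
      (mdeg (u + mhat k)%MM < s)%N].
Proof.
move=> cLM /imfsetP[t /=]; rewrite inE cLM /= => /and4P[tO ct mt tTM] ->.
rewrite submK //; split=> //; rewrite ltn_neqAle (order_ideal_deg hW tO) andbT.
by move: tTM; rewrite in_fset inE tO.
Qed.

(** Since [u mhat_k] is in [O] and [chi_k = x_k^(e_k) mhat_k] is not, [nonO_dom] and cancellation of
    [mhat_k] show that [u] is lex smaller than [x_k^(e_k)] padded by [x_n] to the degree of [u].
    Together with the degree bound this gives the other claims. *)
Lemma seed_spec k u : chi k \in LM r s W -> lv (chi k) = Some k ->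
  u \in seeds r s W k ->
  [/\ (chi k k <= mdeg u)%N, forall j : 'I_n, (j < k)%N -> u j = 0%N,
      (u k < chi k k)%N & listed_before (U_(k) *+ chi k k)%MM u].
Proof.
move=> cLM lvc useed; have [tO ct ts] := mem_seeds cLM useed.
have [cO cs _] := mem_LM hW _ cLM.
have kn := lv_small hW lvc cO cs.
have du : (chi k k <= mdeg u)%N.
  by move: ct; rewrite -{1}(key_cofactorK k) !mdegD mdegMn mdeg1; lia.
have ulex : lexgt (U_(k) *+ chi k k + U_(xn) *+ (mdeg u - chi k k))%MM u.
  rewrite -[lexgt _ _]negbK -lexgeN; apply/negP => ule.
  apply: (negP _ tO); apply: (nonO_dom hW cO ct).
  rewrite -{1}(key_cofactorK k) [(mhat k + _)%MM]addmC -addmA [(mhat k + _)%MM]addmC.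
  rewrite addmA lexge_add2r; apply: lexge_trans ule _.
  have -> : (mdeg (u + mhat k)%MM - mdeg (chi k) = mdeg u - chi k k)%N.
    by rewrite -{1}(key_cofactorK k) !mdegD mdegMn mdeg1; lia.
  exact: lexge_refl.
have [u0 uk] : (forall j : 'I_n, (j < k)%N -> u j = 0%N) /\ (u k < chi k k)%N.
  case/lexgtP: ulex => i; rewrite mnmDE !mulmnE !mnm1E => ui eqi.
  have eqi0 (j : 'I_n) : (j < i)%N -> (j < k)%N -> u j = 0%N.
    move=> ji jk; rewrite -eqi // mnmDE !mulmnE !mnm1E -!val_eqE /=.
    by do 2 (case: eqP; try lia).
  have ki : (k <= i)%N.
    rewrite leqNgt; apply/negP => ik; move: ui; rewrite -!val_eqE /=.
    by do 2 (case: eqP; try lia).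
  have u0 (j : 'I_n) : (j < k)%N -> u j = 0%N by move=> jk; apply: eqi0; lia.
  split=> //; rewrite ltnNge; apply/negP => uk.
  (* If [x_k^(e_k)] divided [u], the cofactor would be lex smaller than the power of [x_n] of its
     own degree. *)
  pose u' := (u - U_(k) *+ chi k k)%MM.
  have uE : u = (U_(k) *+ chi k k + u')%MM.
    rewrite addmC submK //; apply/mnm_lepP => j; rewrite mulmnE mnm1E.
    by case: eqP => [<-|]; rewrite ?mul1n ?mul0n.
  have du' : mdeg u' = (mdeg u - chi k k)%N.
    by rewrite [in RHS]uE mdegD mdegMn mdeg1; lia.
  have := lexge_xlast u'; rewrite lexgeN => /negP; apply.
  rewrite du' -(lexgt_add2r (U_(k) *+ chi k k)%MM) [(u' + _)%MM]addmC -uE addmC.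
  apply/lexgtP; exists i => //.
  by rewrite mnmDE !mulmnE !mnm1E.
split=> //; rewrite /listed_before mdegMn mdeg1 mul1n.
move: du; rewrite leq_eqVlt => /orP[du|->//].
by rewrite du (_ : lexgt _ _); [rewrite orbT|move: ulex; rewrite (eqP du) subnn addm0].
Qed.

(** Replacing [x_k^(e_k)] by a seed moves a monomial later in the listing, which makes the recursion
    for targets well-founded. *)
Lemma target_term_spec m k u : m \notin O -> (mdeg m <= s)%N -> lv m = Some k ->
  u \in seeds r s W k -> let w := (m - U_(k) *+ key_exp r s W k + u)%MM in
  listed_before m w /\ forall j : 'I_n, (j < k)%N -> w j = 0%N.
Proof.
move=> mO ms lvm useed w; have [cLM lvc cm] := key_monomial_spec mO ms lvm.
have [_ u0 _ ub] := seed_spec cLM lvc useed.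
have mE : m = (m - U_(k) *+ key_exp r s W k + U_(k) *+ key_exp r s W k)%MM.
  rewrite submK //; apply/mnm_lepP => j; rewrite mulmnE mnm1E /key_exp.
  by case: eqP => [<-|]; rewrite ?mul1n ?mul0n.
split.
  by rewrite {1}mE /w ![(m - _ + _)%MM]addmC listed_before_add2r.
move=> j jk; rewrite /w mnmDE mnmBE (u0 _ jk).
by case/eqP/lvP: lvm => _ ->.
Qed.

Section LargerVariable.
Variables (m : 'X_{1..n}) (j k : 'I_n).
Hypotheses (mO : m \notin O) (ms : (mdeg m < s)%N) (lvm : lv m = Some k).
Hypothesis jk : (j < k)%N.

(** All variables of [m] are smaller than [x_j], so [m] padded by [x_n] to the same degree is still
    lex smaller than [x_j w]. *)
Lemma larger_variable_nonO w : (mdeg m <= mdeg (U_(j) + w)%MM)%N ->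
  (U_(j) + w)%MM \notin O.
Proof.
move=> dm; apply: (nonO_dom hW mO dm); rewrite lexgeN; apply/lexgtP => -[i].
rewrite !mnmDE mulmnE !mnm1E => lti eqi.
case/eqP/lvP: lvm => _ m0.
have [ik|ki] := ltnP i k.
  move: lti; rewrite (m0 _ ik) -!val_eqE /=; have := ltn_ord k.
  by do 2 (case: eqP; try lia).
have := eqi _ (leq_trans jk ki); rewrite !mnmDE mulmnE !mnm1E (m0 _ jk) eqxx.
by rewrite -val_eqE /=; have := ltn_ord k; case: eqP; try lia.
Qed.

(** Dividing by a variable of [w] keeps the factor [x_j] and a degree of at least [deg m], so this
    quotient is again outside [O]. *)
Lemma larger_variable_notLM w : (mdeg m <= mdeg w)%N -> (U_(j) + w)%MM \notin LM r s W.
Proof.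
move=> mw; apply/negP => /(mem_LM hW)[_ _ divO].
have w0 : (0 < mdeg w)%N by have := nonO_deg hW mO; lia.
have [i /eqP/lvP[wi _]] := lv_exists w0.
have /negP[] : (U_(j) + (w - U_(i)))%MM \notin O.
  apply: larger_variable_nonO; rewrite mdegD mdeg1.
  by rewrite (leq_trans mw) // -{1}(subU_add wi) mdegD mdeg1.
have -> : (U_(j) + (w - U_(i)) = (U_(j) + w) - U_(i))%MM.
  by rewrite addmBA // lep1mP; lia.
by apply: divO; rewrite mnmDE; lia.
Qed.

(** [x_j m] is outside [O], of degree at most [s], and contains [x_j] exactly once; this bounds the
    key exponent by 1. *)
Lemma larger_variable_key : [/\ chi j \in LM r s W, lv (chi j) = Some j & chi j j = 1%N].
Proof.
have mjO : (U_(j) + m)%MM \notin O by rewrite addmC nonO_mul.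
case/eqP/lvP: lvm => _ m0.
have lvj : lv (U_(j) + m)%MM = Some j.
  apply/eqP/lvP; split=> [|i ij]; first by rewrite mnmDE mnm1E eqxx.
  rewrite mnmDE mnm1E m0 ?(ltn_trans ij) // -val_eqE /=.
  by case: eqP; lia.
have [|cLM lvc] := key_monomial_spec mjO _ lvj; first by rewrite mdegD mdeg1.
rewrite mnmDE mnm1E eqxx (m0 _ jk) => c1; split=> //.
by case/eqP/lvP: lvc; lia.
Qed.

End LargerVariable.

End Keys.

(** * Targets and normal forms *)

Section Support.
Variables (n : nat) (B : comNzRingType).
Implicit Types (S T : pred 'X_{1..n}) (p q : {mpoly B[n]}).

Definition supp_in S p : Prop := forall m, m \in msupp p -> S m.

Lemma supp_in0 S : supp_in S 0.
Proof. by move=> m; rewrite msupp0. Qed.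

Lemma supp_inD S p q : supp_in S p -> supp_in S q -> supp_in S (p + q).
Proof. by move=> Sp Sq m /msuppD_le; rewrite mem_cat => /orP[/Sp|/Sq]. Qed.

Lemma supp_inN S p : supp_in S p -> supp_in S (- p).
Proof. by move=> Sp m; rewrite (perm_mem (msuppN _)) => /Sp. Qed.

Lemma supp_inZ S a p : supp_in S p -> supp_in S (a *: p).
Proof. by move=> Sp m /msuppZ_le /Sp. Qed.

Lemma supp_inX S m : S m -> supp_in S 'X_[m].
Proof. by move=> Sm m'; rewrite msuppX inE => /eqP->. Qed.

Lemma supp_in_sum (I : eqType) (L : seq I) (P : pred I) (F : I -> {mpoly B[n]}) S :
  (forall i, i \in L -> P i -> supp_in S (F i)) -> supp_in S (\sum_(i <- L | P i) F i).
Proof.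
move=> SF; rewrite big_seq_cond; apply: big_ind => [||i /andP[]]; last exact: SF.
  exact: supp_in0.
exact: supp_inD.
Qed.

Lemma supp_in_mlin S phi p : (forall m, m \in msupp p -> supp_in S (phi m)) ->
  supp_in S (mlin phi p).
Proof. by move=> h; apply: supp_in_sum => m mp _; apply/supp_inZ/h. Qed.

Lemma supp_inXM S T u p : supp_in S p -> (forall m, S m -> T (u + m)%MM) ->
  supp_in T ('X_[u] * p).
Proof.
move=> Sp ST m; rewrite mulrC (perm_mem (msuppMX _ _)) => /mapP[m' /Sp Sm' ->].
exact: ST.
Qed.

Lemma supp_in_sub S T p : (forall m, S m -> T m) -> supp_in S p -> supp_in T p.
Proof. by move=> ST Sp m /Sp /ST. Qed.

End Support.

Section Targets.
Variables (K : fieldType) (n' r s : nat) (W : nat -> 'X_{1..n'.+1}).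
Hypothesis hW : admissible r s W.
Local Notation n := n'.+1.
Local Notation O := (order_ideal r s W).
Local Notation A := (KCTheta r s W K).
Local Notation chi := (key_monomial r s W).
Local Notation e_ := (key_exp r s W).
Local Notation Y := (Ypoly (@Cvar n r s W K)).
Local Notation tau := (@target n r s W K).
Local Notation tau0 := (@initial_target n r s W K).
Local Notation sig := (@sigma n r s W K).
Implicit Types (m t u w : 'X_{1..n}) (p q : {mpoly A[n]}).

Lemma Ypoly_notLM m : m \notin LM r s W -> Y m = 0.
Proof. by move=> mL; rewrite /Ypoly insubN. Qed.

Lemma Ypoly_LM (b : LM r s W) :
  Y (val b) = - \sum_(t : TM r s W) Cvar K (t, b) *: 'X_[val t].
Proof. by rewrite /Ypoly valK. Qed.

Lemma mem_TM t : (t \in TM r s W) = (t \in O) && (mdeg t == s).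
Proof. by rewrite [LHS]in_fset [LHS]inE. Qed.

Lemma supp_Ypoly m : supp_in (mem (TM r s W)) (Y m).
Proof.
rewrite /Ypoly; case: insubP => [b _ _|_]; last exact: supp_in0.
by apply/supp_inN/supp_in_sum => t _ _; apply/supp_inZ/supp_inX/(valP t).
Qed.

Lemma TM_deg t : t \in TM r s W -> mdeg t = s.
Proof. by rewrite mem_TM => /andP[_ /eqP]. Qed.

Lemma mem_Theta k u : ((k, u) \in Theta r s W) = key r s W k && (u \in seeds r s W k).
Proof.
apply/imfset2P/andP => [[k' /=]|[kk us]].
  by rewrite !inE /= => kk' [u' us [-> ->]].
by exists k; rewrite ?inE //; exists u.
Qed.

Lemma supp_sigma k : supp_in (mem (seeds r s W k)) (sig k).
Proof.
apply: supp_in_sum => -[[k' u] /= kuT] _ /= /eqP kk; apply/supp_inZ/supp_inX.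
by move: (kuT); rewrite mem_Theta kk => /andP[].
Qed.

Lemma trunc_mlin d p : trunc d p = mlin (fun m => if (mdeg m <= d)%N then 'X_[m] else 0) p.
Proof.
rewrite /trunc big_mkcond; apply: eq_bigr => m _.
by case: ifP => // _; rewrite scaler0.
Qed.

(** The initial target before truncation. Both have the same normal form, as [NFX] vanishes above
    degree [s], and this one commutes with multiplication by a variable that does not change the
    leading variable. *)
Definition raw_target m k : {mpoly A[n]} := 'X_[m - U_(k) *+ e_ k] * sig k.

Lemma initial_targetE m k : (mdeg m <= s)%N -> lv m = Some k ->
  tau0 m = trunc s (raw_target m k).
Proof. by move=> ms lvm; rewrite /initial_target ms lvm. Qed.

Lemma initial_target_high m : (s < mdeg m)%N -> tau0 m = 0.
Proof. by move=> ms; rewrite /initial_target leqNgt ms. Qed.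

Lemma supp_raw_target m k : m \notin O -> (mdeg m <= s)%N -> lv m = Some k ->
  supp_in (fun w => listed_before m w &&
    [forall j : 'I_n, (j < k)%N ==> (w j == 0%N)]) (raw_target m k).
Proof.
move=> mO ms lvm; apply: supp_inXM (@supp_sigma k) _ => u us.
have [-> w0] := target_term_spec hW mO ms lvm us.
by apply/forallP => j; apply/implyP => /w0 ->.
Qed.

Lemma lv_of_nonO m : m \notin O -> exists k, lv m = Some k.
Proof. by move=> mO; apply: lv_exists; have := nonO_deg hW mO; lia. Qed.

Lemma supp_trunc S d p : supp_in S p -> supp_in S (trunc d p).
Proof.
move=> Sp; rewrite trunc_mlin; apply: supp_in_mlin => m /Sp Sm.
by case: ifP => _; [apply: supp_inX|apply: supp_in0].
Qed.

Lemma supp_initial_target m : m \notin O ->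
  supp_in (listed_before m) (tau0 m).
Proof.
move=> mO; have [ms|ms] := leqP (mdeg m) s; last first.
  by rewrite initial_target_high //; apply: supp_in0.
have [k lvm] := lv_of_nonO mO; rewrite (initial_targetE ms lvm).
apply: supp_trunc; apply: supp_in_sub (supp_raw_target mO ms lvm) => w /=.
by case/andP.
Qed.

(* The normal form of the monomial [m] modulo [MG]; [NF] is its linear extension. *)
Definition NFX m : {mpoly A[n]} := if m \in O then 'X_[m] else - (Y m + tau m).
Local Notation NF := (mlin NFX).

Lemma target_notN m : m \notin nonO r s W -> tau m = 0.
Proof.
rewrite /target -(@mem_sort _ (@negdeglex n)).
elim: (sort _ _) => //= a L IHL; rewrite inE negb_or => /andP[/negPf-> /IHL].
by [].
Qed.

Lemma target_high m : (s < mdeg m)%N -> tau m = 0.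
Proof.
move=> ms; have [mN|/target_notN//] := boolP (m \in nonO r s W).
suff h (L : seq 'X_{1..n}) : foldr (fun m tau m' => if m' == m then
    replace_nonO tau (initial_target r s W K m) else tau m') (fun=> 0) L m = 0.
  exact: h.
elim: L => //= a L IHL; case: eqP => // <-.
by rewrite initial_target_high // /replace_nonO msupp0 big_nil.
Qed.

(** The fold satisfies its recursive equation: the terms of the initial target come strictly after
    [m], where the partial function available when [m] is processed already agrees with the final
    one. *)
Lemma targetE m : m \notin O -> tau m = NF (tau0 m).
Proof.
move=> mO; have [ms|ms] := leqP (mdeg m) s; last first.
  by rewrite target_high // initial_target_high // linear0.
have : m \in sort (@negdeglex n) (enum_fset (nonO r s W)).
  by rewrite mem_sort mem_nonO // mO; lia.
rewrite /NFX /target.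
have : pairwise (@negdeglex n) (sort (@negdeglex n) (enum_fset (nonO r s W))).
  rewrite -sorted_pairwise; last exact: negdeglex_trans.
  by apply: sort_sorted; apply: negdeglex_total.
elim: (sort _ _) => //= a L IHL /andP[/allP aL /IHL{}IHL].
rewrite inE; case: (eqVneq m a) => [<- _|ma /= mL].
  apply: eq_mlin_supp => m' /(supp_initial_target mO) mm'.
  by case: (eqVneq m' m) mm' => // ->; rewrite listed_before_irr.
rewrite IHL //; apply: eq_mlin_supp => m' /(supp_initial_target mO) mm'.
case: (eqVneq m' a) mm' => // -> ma'; have := aL _ mL; rewrite negdeglexE.
rewrite eq_sym (negPf ma) /= => /listed_before_trans /(_ ma').
by rewrite listed_before_irr.
Qed.

Lemma NFX_O m : m \in O -> NFX m = 'X_[m].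
Proof. by rewrite /NFX => ->. Qed.

Lemma NFX_nonO m : m \notin O -> NFX m = - (Y m + tau m).
Proof. by rewrite /NFX => /negPf->. Qed.

Lemma LM_deg m : m \in LM r s W -> (mdeg m <= s)%N.
Proof. by case/(mem_LM hW). Qed.

Lemma NFX_high m : (s < mdeg m)%N -> NFX m = 0.
Proof.
move=> ms; rewrite NFX_nonO.
  rewrite target_high // Ypoly_notLM ?addr0 ?oppr0 //.
  by apply/negP => /LM_deg; rewrite leqNgt ms.
by apply/negP => /(order_ideal_deg hW); rewrite leqNgt ms.
Qed.

Lemma NF_high p : supp_in (fun m => (s < mdeg m)%N) p -> NF p = 0.
Proof.
move=> hp; rewrite /mlin big_seq big1 // => m /hp ms.
by rewrite NFX_high // scaler0.
Qed.

Lemma NF_trunc p : NF (trunc s p) = NF p.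
Proof.
rewrite trunc_mlin [X in mlin _ X = _]/mlin linear_sum; apply: eq_bigr => m _.
rewrite linearZ /=; case: leqP => ms; first by rewrite mlinX.
by rewrite linear0 NFX_high.
Qed.

Lemma target_raw m k : m \notin O -> (mdeg m <= s)%N -> lv m = Some k ->
  tau m = NF (raw_target m k).
Proof. by move=> mO ms lvm; rewrite targetE // (initial_targetE ms lvm) NF_trunc. Qed.

Lemma supp_YO m : supp_in (mem O) (Y m).
Proof.
by apply: supp_in_sub (@supp_Ypoly m) => t /=; rewrite mem_TM => /andP[].
Qed.

Lemma supp_targetO m : supp_in (mem O) (tau m).
Proof.
have [md|/target_high->] := leqP (mdeg m) s; last exact: supp_in0.
have [mO|mO] := boolP (m \in O).
  by rewrite target_notN ?mem_nonO ?mO //; apply: supp_in0.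
move: m md mO; apply: listed_ind => m md IHm mO.
rewrite targetE //; apply: supp_in_mlin => w /(supp_initial_target mO) mw.
rewrite /NFX; case: ifP => wO; first exact/supp_inX.
apply/supp_inN/supp_inD; first exact: supp_YO.
have [ws|/target_high->] := leqP (mdeg w) s; last exact: supp_in0.
by apply: IHm; rewrite ?wO.
Qed.

Lemma supp_NFXO m : supp_in (mem O) (NFX m).
Proof.
rewrite /NFX; case: ifP => wO; first exact/supp_inX.
by apply/supp_inN/supp_inD; [apply: supp_YO|apply: supp_targetO].
Qed.

Lemma NF_idem p : NF (NF p) = NF p.
Proof.
rewrite -[RHS]mlin_id; apply: eq_mlin_supp => m mp; apply: NFX_O.
exact: (supp_in_mlin (fun m' _ => @supp_NFXO m') mp).
Qed.

Lemma supp_target_after m : m \notin O -> supp_in (listed_before m) (tau m).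
Proof.
move=> mO; have [md|/target_high->] := leqP (mdeg m) s; last exact: supp_in0.
move: m md mO; apply: listed_ind => m md IHm mO.
rewrite targetE //; apply: supp_in_mlin => w /(supp_initial_target mO) mw.
rewrite /NFX; case: ifP => wO; first exact/supp_inX.
have [ws|ws] := leqP (mdeg w) s; last first.
  rewrite target_high // Ypoly_notLM ?addr0 ?oppr0; first exact: supp_in0.
  by apply/negP => /LM_deg; rewrite leqNgt ws.
apply/supp_inN/supp_inD; last first.
  apply: supp_in_sub (IHm _ ws mw _); last by rewrite wO.
  by move=> x; apply: listed_before_trans mw.
have [wL|wL] := boolP (w \in LM r s W); last by rewrite Ypoly_notLM //; apply: supp_in0.
apply: supp_in_sub (@supp_Ypoly w) => t tM.
have tw : (mdeg w <= mdeg t)%N by rewrite (TM_deg tM).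
(* As [t] has degree [s], only [deg m = s] is delicate. Then [w] outside [O] and [t] in [O] have the
   same degree, and [t] is lex smaller because [O] is a lex segment there. *)
have [lt_mt|] := ltnP (mdeg m) (mdeg t); first by rewrite /listed_before lt_mt.
rewrite (TM_deg tM) => sm; have mdw := listed_before_deg mw.
have {}ms : mdeg m = s by lia.
have wds : mdeg w = s by lia.
have tO : t \in O by move: tM; rewrite /= mem_TM => /andP[].
have tlw : lexgt w t.
  rewrite -[lexgt _ _]negbK -lexgeN; apply/negP => tgew.
  by apply: (negP _ tO); apply: (nonO_lex hW (negbT wO)) => //; rewrite (TM_deg tM).
apply: listed_before_trans mw _.
by rewrite /listed_before wds (TM_deg tM) eqxx tlw orbT.
Qed.

Lemma supp_NFX_after m : m \notin O -> (mdeg m < s)%N ->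
  supp_in (listed_before m) (NFX m).
Proof.
move=> mO ms; rewrite NFX_nonO //; apply/supp_inN/supp_inD.
  apply: supp_in_sub (@supp_Ypoly m) => t tM.
  by rewrite /listed_before (TM_deg tM) ms.
exact: supp_target_after.
Qed.

Lemma supp_NF_after m p : (mdeg m < s)%N ->
  supp_in (listed_before m) p -> supp_in (listed_before m) (NF p).
Proof.
move=> ms hp; apply: supp_in_mlin => w /hp mw; rewrite /NFX.
case: ifP => wO; first exact/supp_inX.
apply/supp_inN/supp_inD; last first.
  apply: supp_in_sub (supp_target_after (negbT wO)) => x.
  exact: listed_before_trans mw.
apply: supp_in_sub (@supp_Ypoly w) => t tM.
by rewrite /listed_before (TM_deg tM) ms.
Qed.

End Targets.

(** * Compatibility of the normal form with multiplication by variables *)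

Section Stability.
Variables (K : fieldType) (n' r s : nat) (W : nat -> 'X_{1..n'.+1}).
Hypothesis hW : admissible r s W.
Local Notation n := n'.+1.
Local Notation O := (order_ideal r s W).
Local Notation A := (KCTheta r s W K).
Local Notation e_ := (key_exp r s W).
Local Notation Y := (Ypoly (@Cvar n r s W K)).
Local Notation tau := (@target n r s W K).
Local Notation sig := (@sigma n r s W K).
Local Notation raw := (@raw_target K n' r s W).
Local Notation NF := (mlin (@NFX K n' r s W)).
Implicit Types (m t u w : 'X_{1..n}) (p q : {mpoly A[n]}).

Definition stable m : Prop :=
  forall j, NF ('X_[U_(j)] * NF 'X_[m]) = NF ('X_[U_(j)] * 'X_[m]).

Lemma listed_before_mul m w u : listed_before m w -> listed_before m (u + w)%MM.
Proof.
rewrite /listed_before mdegD => /orP[h|/andP[/eqP mw h]].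
  by rewrite (leq_trans h) // leq_addl.
case: (eqVneq u 0%MM) => [->|u0]; first by rewrite mdeg0 mw add0m h eqxx orbT.
by rewrite mw -[X in (X < _)%N]add0n ltn_add2r lt0n mdeg_eq0 u0.
Qed.

Lemma linear_fun_eq_supp (f g : {mpoly A[n]} -> {mpoly A[n]}) p :
  linear f -> linear g -> (forall m, m \in msupp p -> f 'X_[m] = g 'X_[m]) ->
  f p = g p.
Proof.
move=> lf lg.
pose Lf := GRing.isLinear.Build A {mpoly A[n]} {mpoly A[n]} *:%R f lf.
pose Lg := GRing.isLinear.Build A {mpoly A[n]} {mpoly A[n]} *:%R g lg.
pose F : {linear {mpoly A[n]} -> {mpoly A[n]}} := HB.pack f Lf.
pose G : {linear {mpoly A[n]} -> {mpoly A[n]}} := HB.pack g Lg.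
exact: (@eq_linear_supp n A F G).
Qed.

Lemma NF_stable_supp (j : 'I_n) p : (forall m, m \in msupp p -> stable m) ->
  NF ('X_[U_(j)] * NF p) = NF ('X_[U_(j)] * p).
Proof.
move=> st; apply: (@linear_fun_eq_supp (fun p => NF ('X_[U_(j)] * NF p))
  (fun p => NF ('X_[U_(j)] * p))) => [a x y|a x y|m /st].
- by rewrite linearP mulrDr -scalerAr linearP.
- by rewrite mulrDr -scalerAr linearP.
exact.
Qed.

Lemma stable_high m : (s < mdeg m)%N -> stable m.
Proof.
move=> ms j; rewrite mlinX (NFX_high K hW) // mulr0 linear0 -mpolyXD mlinX (NFX_high K hW) //.
by rewrite mdegD; lia.
Qed.

Lemma stable_O m : m \in O -> stable m.
Proof. by move=> mO j; rewrite mlinX NFX_O. Qed.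

Lemma mpolyX_split u (j : 'I_n) : (0 < u j)%N ->
  'X_[u] = 'X_[U_(j)] * 'X_[(u - U_(j))%MM] :> {mpoly A[n]}.
Proof. by move=> uj; rewrite -mpolyXD subU_add. Qed.

Section Step.
Variable m : 'X_{1..n}.
Hypotheses (mO : m \notin O) (ms : (mdeg m < s)%N).
Hypothesis IHm : forall w, listed_before m w -> stable w.

(** Extends stability from one variable to a monomial by peeling off variables of [u]: products stay
    after [m], so each intermediate normal form can be inserted or removed. *)
Lemma NF_mulX_after u p : supp_in (listed_before m) p ->
  NF ('X_[u] * NF p) = NF ('X_[u] * p).
Proof.
move=> hp; have [d] := ubnP (mdeg u); elim: d u => [//|d IHd] u ud.
case: (eqVneq u 0%MM) => [->|]; first by rewrite mpolyX0 !mul1r (NF_idem hW).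
rewrite -mdeg_eq0 -lt0n => /lv_exists[j /eqP/lvP[uj _]].
have du : mdeg u = (mdeg (u - U_(j))%MM).+1 by rewrite -{1}(subU_add uj) mdegD mdeg1.
have after q : supp_in (listed_before m) q ->
    forall w, w \in msupp ('X_[u - U_(j)] * q) -> stable w.
  move=> hq w wq; apply: IHm; apply: (supp_inXM hq) wq => x.
  exact: listed_before_mul.
rewrite (mpolyX_split uj) -!mulrA -(NF_stable_supp _ (after _ hp)).
rewrite -IHd; last by lia.
by rewrite NF_stable_supp; [|apply: after; apply: supp_NF_after].
Qed.

(** Here [u] involves only variables smaller than [x_j]. One of them is absorbed by the first
    hypothesis; the others act on monomials listed after [m], where [IHm] applies. *)
Lemma NF_mulX_larger (j : 'I_n) u :
  (forall i : 'I_n, (j < i)%N -> NF ('X_[U_(i)] * NF 'X_[m]) = NF ('X_[U_(i)] * 'X_[m])) ->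
  (forall i : 'I_n, (i <= j)%N -> u i = 0%N) ->
  NF ('X_[u] * NF 'X_[m]) = NF ('X_[u] * 'X_[m]).
Proof.
move=> IHj; have [d] := ubnP (mdeg u); elim: d u => [//|d IHd] u ud u0.
case: (eqVneq u 0%MM) => [->|]; first by rewrite mpolyX0 !mul1r (NF_idem hW).
rewrite -mdeg_eq0 -lt0n => /lv_exists[i /eqP/lvP[ui _]].
have ji : (j < i)%N by rewrite ltnNge; apply/negP => /u0; lia.
have du : mdeg u = (mdeg (u - U_(i))%MM).+1 by rewrite -{1}(subU_add ui) mdegD mdeg1.
rewrite (mpolyX_split ui) -!mulrA.
case: (eqVneq (u - U_(i))%MM 0%MM) => [->|u'0].
  by rewrite mpolyX0 !mul1r IHj.
have after : supp_in (listed_before m) ('X_[u - U_(i)] * NF 'X_[m]).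
  rewrite mlinX; apply: supp_inXM (@supp_NFX_after K n' r s W hW m mO ms) _.
  by move=> w; apply: listed_before_mul.
rewrite -(NF_stable_supp _ (fun w wq => IHm (after w wq))) IHd; first last.
- by move=> k kj; rewrite mnmBE u0.
- by lia.
rewrite NF_stable_supp // => w; rewrite -mpolyXD msuppX inE => /eqP->.
apply: IHm; rewrite /listed_before mdegD -[X in (X < _)%N]add0n ltn_add2r.
by rewrite lt0n mdeg_eq0 u'0.
Qed.

Lemma NF_mul_sum (k : 'I_n) p q : (forall u, u \in seeds r s W k ->
    NF ('X_[u] * p) = NF ('X_[u] * q)) -> NF (sig k * p) = NF (sig k * q).
Proof.
move=> h; apply: (@linear_fun_eq_supp (fun x => NF (x * p)) (fun x => NF (x * q)))
  => [a x y|a x y|u /supp_sigma /h //];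
by rewrite mulrDl -scalerAl linearP.
Qed.

(* Here [x_j m] has a larger leading variable than [m], so [e_j = 1] and the seeds
   of [x_j] only involve smaller variables.  Both sides reduce to minus the normal
   form of [sigma_j] times the initial target of [m]: for the right-hand side,
   every [x_j w] with [w] in that target lies outside [O] and [LM]. *)
Lemma stable_step_larger (j k : 'I_n) : lv m = Some k -> (j < k)%N ->
  (forall i : 'I_n, (j < i)%N -> NF ('X_[U_(i)] * NF 'X_[m]) = NF ('X_[U_(i)] * 'X_[m])) ->
  tau (U_(j) + m)%MM = NF ('X_[U_(j)] * raw m k).
Proof.
move=> lvm jk IHj; have [cLM lvc c1] := larger_variable_key hW mO ms lvm jk.
have e1 : e_ j = 1%N by [].
have seed u : u \in seeds r s W j ->
    (0 < mdeg u)%N /\ forall i : 'I_n, (i <= j)%N -> u i = 0%N.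
  move=> us; have [u1 u0 uj _] := seed_spec hW cLM lvc us; split; first by rewrite -c1.
  move=> i; rewrite leq_eqVlt => /orP[/eqP/val_inj->|/u0//].
  by move: uj; rewrite c1; lia.
have lvadd w : (forall i : 'I_n, (i < k)%N -> w i = 0%N) -> lv (U_(j) + w)%MM = Some j.
  move=> w0; apply/eqP/lvP; rewrite mnmDE mnm1E eqxx; split=> // i ij.
  rewrite mnmDE mnm1E w0 ?(ltn_trans ij) // -val_eqE /=; case: eqP; lia.
have rawadd w : raw (U_(j) + w)%MM j = sig j * 'X_[w].
  rewrite /raw_target e1 mulm1n mulrC; congr (_ * 'X_[_]).
  by rewrite addmC addmK.
have m0 : forall i : 'I_n, (i < k)%N -> m i = 0%N by case/eqP/lvP: lvm.
have sm : supp_in (listed_before m) (raw m k).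
  apply: supp_in_sub (supp_raw_target hW mO (ltnW ms) lvm) => w.
  by case/andP.
have -> : tau (U_(j) + m)%MM = - NF (sig j * raw m k).
  rewrite (@target_raw _ _ _ _ _ hW _ j); first last.
  - exact: lvadd.
  - by rewrite mdegD mdeg1.
  - by rewrite addmC nonO_mul.
  rewrite rawadd -linearN /= -mulrN.
  transitivity (NF (sig j * NF 'X_[m])).
    apply: NF_mul_sum => u us; rewrite (@NF_mulX_larger j) //.
    by case: (seed _ us).
  apply: NF_mul_sum => u us; rewrite mlinX NFX_nonO // !mulrN !linearN /=.
  (* Terms of [Y m] have degree [s] and seeds have positive degree, so this product lies above
     degree [s]. *)
  rewrite mulrDr linearD /= [X in X + _](NF_high hW) ?add0r.
    by rewrite (target_raw K hW mO (ltnW ms) lvm) NF_mulX_after.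
  apply: supp_inXM (@supp_Ypoly K n' r s W m) _ => t tM.
  by rewrite mdegD (TM_deg tM); case: (seed _ us); lia.
apply/esym; rewrite -linearN /=.
apply: (@linear_fun_eq_supp (fun p => NF ('X_[U_(j)] * p)) (fun p => NF (- (sig j * p))))
  => [a x y|a x y|w /(supp_raw_target hW mO (ltnW ms) lvm)].
- by rewrite mulrDr -scalerAr linearP.
- by rewrite mulrDr -scalerAr opprD -scalerN linearP.
case/andP => mw /forallP w0.
have {}w0 (i : 'I_n) : (i < k)%N -> w i = 0%N by move=> ik; apply/eqP/(implyP (w0 i)).
have dmw := listed_before_deg mw.
(* If [deg w >= s], both sides vanish for degree reasons. *)
rewrite -mpolyXD mlinX; have [ws|ws] := ltnP (mdeg w) s; last first.
  rewrite (NFX_high K hW) ?mdegD ?mdeg1 // (NF_high hW) //.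
  apply: supp_inN; rewrite mulrC; apply: supp_inXM (@supp_sigma K n' r s W j) _ => u /= us.
  by rewrite mdegD; case: (seed _ us); lia.
have wO : (U_(j) + w)%MM \notin O.
  by apply: (larger_variable_nonO hW mO ms lvm jk); rewrite mdegD; lia.
rewrite NFX_nonO // Ypoly_notLM ?add0r; last first.
  exact: (larger_variable_notLM hW mO ms lvm jk).
rewrite (@target_raw _ _ _ _ _ hW _ j) ?rawadd ?linearN //; last exact: lvadd.
by rewrite mdegD mdeg1.
Qed.

(** [x_j] does not exceed the leading variable of [m], so [x_j m] uses the same key monomial and
    seeds, and its raw target is [x_j] times that of [m]. *)
Lemma stable_step_small (j k : 'I_n) : lv m = Some k -> (k <= j)%N ->
  tau (U_(j) + m)%MM = NF ('X_[U_(j)] * raw m k).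
Proof.
move=> lvm kj; rewrite (@target_raw _ _ _ _ _ hW _ k); first last.
- case/eqP/lvP: lvm => mk m0; apply/eqP/lvP; rewrite mnmDE; split; first by lia.
  move=> i ik; rewrite mnmDE mnm1E (m0 _ ik) -val_eqE /=; case: eqP; lia.
- by rewrite mdegD mdeg1.
- by rewrite addmC nonO_mul.
rewrite /raw_target mulrA -mpolyXD addmBA //.
have [_ _ cm] := key_monomial_spec hW mO (ltnW ms) lvm.
apply/mnm_lepP => i; rewrite mulmnE mnm1E.
by case: eqP => [<-|]; rewrite ?mul1n ?mul0n.
Qed.

End Step.

Lemma NF_stable m : stable m.
Proof.
have [md|/stable_high//] := leqP (mdeg m) s.
move: m md; apply: listed_ind => m md IHm.
have [/stable_O//|mO] := boolP (m \in O).
have {}IHm w : listed_before m w -> stable w.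
  by have [ws|/stable_high//] := leqP (mdeg w) s; apply: IHm.
have [k lvm] := lv_of_nonO hW mO.
(* Only targets need comparing: [x_j m] has the quotient [m] outside [O], hence is not in [LM], and
   [x_j Y(m)] has degree [s+1]. *)
suff tauE (j : 'I_n) : (forall i : 'I_n, (j < i)%N ->
     NF ('X_[U_(i)] * NF 'X_[m]) = NF ('X_[U_(i)] * 'X_[m])) ->
   tau (U_(j) + m)%MM = NF ('X_[U_(j)] * tau m).
  (* Inner induction from [x_n] up to [x_1], since a variable beyond the leading one relies on the
     smaller variables. *)
  move=> j; have [d] := ubnP (n - j)%N; elim: d j => [//|d IHd] j jd.
  have jO : (U_(j) + m)%MM \notin O by rewrite addmC nonO_mul.
  rewrite -mpolyXD !mlinX !NFX_nonO // [Y (_ + _)%MM]Ypoly_notLM; last first.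
    apply/negP => /(mem_LM hW)[_ _ /(_ j)]; rewrite addmC addmK mnmDE mnm1E eqxx.
    by rewrite addn1 (negPf mO) => /(_ isT).
  rewrite add0r tauE; last first.
    by move=> i ji; apply: IHd; have := ltn_ord i; lia.
  rewrite mulrN linearN /= mulrDr linearD /= [X in X + _](NF_high hW) ?add0r //.
  apply: supp_inXM (@supp_Ypoly K n' r s W m) _ => t tM.
  by rewrite mdegD mdeg1 (TM_deg tM).
move=> IHj; have tm := target_raw K hW mO md lvm.
have rm : supp_in (listed_before m) (raw m k).
  by apply: supp_in_sub (supp_raw_target hW mO md lvm) => w /andP[].
have -> : NF ('X_[U_(j)] * tau m) = NF ('X_[U_(j)] * raw m k).
  by rewrite tm; apply: NF_stable_supp => w /rm /IHm.
have [ms|sm] := ltnP (mdeg m) s; last first.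
  rewrite target_high ?mdegD ?mdeg1 // (NF_high hW) //.
  apply: supp_inXM rm _ => w /listed_before_deg; rewrite mdegD mdeg1; lia.
have [kj|jk] := leqP k j; first exact: stable_step_small.
exact: stable_step_larger.
Qed.

Lemma NF_mulX (j : 'I_n) p : NF ('X_[U_(j)] * NF p) = NF ('X_[U_(j)] * p).
Proof. by apply: NF_stable_supp => m _; apply: NF_stable. Qed.

End Stability.

(** * Quotients, spectra and Krull dimension *)

Section AlgebraEvaluation.
Variables (K : comNzRingType) (A : comAlgType K) (n : nat) (h : 'I_n -> A).

Definition alg_eval : {mpoly K[n]} -> A := mmap (GRing.in_alg A) h.

HB.instance Definition _ := GRing.RMorphism.copy alg_eval (mmap (GRing.in_alg A) h).

Lemma alg_eval_is_scalable : scalable alg_eval.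
Proof. by move=> a p; rewrite /alg_eval mmapZ mulr_algl. Qed.

HB.instance Definition _ :=
  GRing.isScalable.Build K {mpoly K[n]} A *:%R alg_eval alg_eval_is_scalable.

Lemma alg_evalX i : alg_eval 'X_i = h i.
Proof. by rewrite /alg_eval mmapX mmap1U. Qed.

Lemma alg_evalXm m : alg_eval 'X_[m] = \prod_(i < n) h i ^+ m i.
Proof. by rewrite /alg_eval mmapX. Qed.

Lemma alg_evalE p : alg_eval p = \sum_(m <- msupp p) p@_m *: \prod_(i < n) h i ^+ m i.
Proof. by apply: eq_bigr => m _; rewrite mulr_algl. Qed.

End AlgebraEvaluation.

Lemma lrmorph_alg_eval (K : comNzRingType) (A B : comAlgType K) n (h : 'I_n -> A)
  (phi : {lrmorphism A -> B}) p : phi (alg_eval h p) = alg_eval (phi \o h) p.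
Proof.
rewrite !alg_evalE linear_sum; apply: eq_bigr => m _; rewrite linearZ rmorph_prod.
by congr (_ *: _); apply: eq_bigr => i _; rewrite rmorphXn.
Qed.

Lemma eq_alg_eval (K : comNzRingType) (A : comAlgType K) n (h h' : 'I_n -> A) p :
  h =1 h' -> alg_eval h p = alg_eval h' p.
Proof.
move=> hh; rewrite !alg_evalE; apply: eq_bigr => m _; congr (_ *: _).
by apply: eq_bigr => i _; rewrite hh.
Qed.

Section QuotientLift.
Variables (K : comNzRingType) (A B : comAlgType K) (I : idealr A).
Variable f : {lrmorphism A -> B}.
Hypothesis fI : forall a, a \in I -> f a = 0.
Local Notation Q := {ideal_quot I}.

Definition quot_lift_fun (x : Q) : B := f (repr x).

Lemma quot_lift_pi a : quot_lift_fun (\pi_Q a) = f a.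
Proof.
apply/eqP; rewrite /quot_lift_fun -subr_eq0 -rmorphB; apply/eqP/fI.
by rewrite Quotient.idealrBE reprK.
Qed.

Lemma quot_lift_zmod : zmod_morphism quot_lift_fun.
Proof.
by move=> x y; rewrite -[x]reprK -[y]reprK -rmorphB !quot_lift_pi rmorphB.
Qed.

Lemma quot_lift_monoid : monoid_morphism quot_lift_fun.
Proof.
split=> [|x y]; first by rewrite -(rmorph1 (\pi_Q)) quot_lift_pi rmorph1.
by rewrite -[x]reprK -[y]reprK -rmorphM !quot_lift_pi rmorphM.
Qed.

Lemma quot_lift_scalable : scalable quot_lift_fun.
Proof.
move=> a x; rewrite -[x]reprK [a *: _]quot_scale_pi !quot_lift_pi.
exact: linearZ.
Qed.

HB.instance Definition _ := GRing.isZmodMorphism.Build Q B quot_lift_fun quot_lift_zmod.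
HB.instance Definition _ := GRing.isMonoidMorphism.Build Q B quot_lift_fun quot_lift_monoid.
HB.instance Definition _ :=
  GRing.isScalable.Build K Q B *:%R quot_lift_fun quot_lift_scalable.

Definition quot_lift : {lrmorphism Q -> B} := quot_lift_fun.

End QuotientLift.

Lemma mem_ker_ideal (A B : comNzRingType) (f : {rmorphism A -> B}) a :
  (a \in ker_ideal f) = (f a == 0).
Proof. by []. Qed.

Lemma ker_quotient_iso (K : comNzRingType) (A B : comAlgType K) (I : idealr A)
    (f : {lrmorphism A -> B}) : (forall a, (a \in I) = (f a == 0)) ->
  (forall b, exists a, f a = b) ->
  exists g : {lrmorphism {ideal_quot I} -> B}, bijective g.
Proof.
move=> If fsurj; have fI a : a \in I -> f a = 0 by rewrite If => /eqP.
have [sec secK] := choice fsurj.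
exists (quot_lift fI); exists (fun b => \pi_{ideal_quot I} (sec b)).
  move=> x; rewrite -[x]reprK /=; apply/eqP.
  rewrite (quot_lift_pi fI) -Quotient.idealrBE If rmorphB /=.
  by rewrite secK subrr.
by move=> b; rewrite /= (quot_lift_pi fI) secK.
Qed.

Section PrimeKernel.
Variables (A : comNzRingType) (B : idomainType) (f : {rmorphism A -> B}).

Lemma rker_prime : prime_idealr_closed (rker f).
Proof. by move=> u v; rewrite !inE rmorphM mulf_eq0. Qed.

HB.instance Definition _ := isPrimeIdealrClosed.Build A (rker f) rker_prime.

Definition prime_ker : prime_idealr A := rker f.

(** The kernel is prime and is the generic point: whatever vanishes there vanishes on the whole
    locus. *)
Lemma zero_locus_ker_irreducible : irreducible_subset (zero_locus (ker_ideal f)).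
Proof.
split=> [|S T ST]; first by exists prime_ker.
by case: (ST prime_ker) => // sub; [left|right] => P kerP a /sub /kerP.
Qed.

End PrimeKernel.

Section PrimePushforward.
Variables (A B : comNzRingType) (f : {rmorphism A -> B}) (P : prime_idealr A).
Hypotheses (fsurj : forall b, exists a, f a = b) (kerP : zero_locus (ker_ideal f) P).

Definition push_prime_pred : {pred B} := [pred b | `[< exists2 a, a \in P & f a = b >]].

(** Two preimages of one element differ by an element of the kernel, which [P] contains. *)
Lemma mem_push_prime a : (f a \in push_prime_pred) = (a \in P).
Proof.
rewrite inE; apply/asboolP/idP => [[c cP fc]|aP]; last by exists a.
rewrite -(subrK c a) rpredD //; apply: kerP.
by rewrite mem_ker_ideal rmorphB fc subrr.
Qed.

Lemma push_prime_closed : idealr_closed push_prime_pred.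
Proof.
split; first by rewrite -(rmorph0 f) mem_push_prime rpred0.
  by rewrite -(rmorph1 f) mem_push_prime idealr1.
move=> a u v; have [[[c <-] [d <-]] [e <-]] := (fsurj a, fsurj u, fsurj v).
by rewrite -rmorphM -rmorphD !mem_push_prime => dP eP; rewrite rpredD // idealMr.
Qed.

Lemma push_prime_prime : prime_idealr_closed push_prime_pred.
Proof.
move=> u v; have [[c <-] [d <-]] := (fsurj u, fsurj v).
by rewrite -rmorphM !mem_push_prime prime_idealrM.
Qed.

HB.instance Definition _ := isIdealr.Build B push_prime_pred push_prime_closed.
HB.instance Definition _ := isPrimeIdealrClosed.Build B push_prime_pred push_prime_prime.

Definition push_prime : prime_idealr B := push_prime_pred.

End PrimePushforward.

(** A prime containing the kernel is the preimage of its own image under the surjection. *)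
Lemma spec_image_surj (A B : comNzRingType) (f : {rmorphism A -> B})
    (P : prime_idealr A) : (forall b, exists a, f a = b) ->
  spec_image f P <-> zero_locus (ker_ideal f) P.
Proof.
move=> fsurj; split=> [[q Pq] a|kerP].
  by rewrite mem_ker_ideal Pq => /eqP ->; apply: rpred0.
exists (push_prime fsurj kerP) => a.
by rewrite -(mem_push_prime kerP).
Qed.

Section KrullUpperBound.
Variables (K : fieldType) (Q : comAlgType K) (N : nat) (x : 'I_N -> Q).
Variables (p : {mpoly K[N]}) (P : nat -> prime_idealr Q).
Hypotheses (p0 : p != 0) (px : alg_eval x p = 0).
Hypothesis subP : forall i, (i < N)%N -> {subset P i <= P i.+1}.
Hypotheses (xP : forall i : 'I_N, x i \in P i.+1) (xnP : forall i : 'I_N, x i \notin P i).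

Lemma prime_scale (q : prime_idealr Q) (a : K) u : u \in q -> a *: u \in q.
Proof. by move=> uq; rewrite -mulr_algl idealMr. Qed.

Lemma prime_expr (q : prime_idealr Q) u k : u \notin q -> u ^+ k \notin q.
Proof.
move=> uq; elim: k => [|k IHk]; first by rewrite expr0 idealr1.
by rewrite exprS prime_idealrM negb_or uq.
Qed.

(* The relation [p] is peeled off along its lexicographically smallest term
   [m0]: [tail m0 i] collects the terms agreeing with [m0] in the first [i]
   exponents, stripped of the corresponding powers. *)
Definition tail (m0 : 'X_{1..N}) (i : nat) : Q :=
  \sum_(m <- msupp p | [forall j : 'I_N, (j < i)%N ==> (m j == m0 j)])
    p@_m *: \prod_(j : 'I_N | (i <= j)%N) x j ^+ m j.

Lemma tail_in (m0 : 'X_{1..N}) i :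
  (forall m, m \in msupp p -> lexge m m0) -> (i <= N)%N -> tail m0 i \in P i.
Proof.
move=> minm0; elim: i => [_|i IHi iN].
  have -> : tail m0 0 = 0.
    by rewrite -px alg_evalE; apply: eq_bigl => m; apply/forallP.
  exact: rpred0.
pose k := Ordinal iN; pose S m := [forall j : 'I_N, (j < i)%N ==> (m j == m0 j)].
pose rest m := \prod_(j : 'I_N | (i < j)%N) x j ^+ m j.
have Sk m : m \in msupp p -> S m -> (m0 k <= m k)%N.
  move=> mp /forallP Sm; rewrite leqNgt; apply/negP => lt_m.
  have := minm0 _ mp; rewrite lexgeN => /negP; apply; apply/lexgtP; exists k => // j ji.
  by apply/esym/eqP/(implyP (Sm j)).
pose t := \sum_(m <- msupp p | S m) p@_m *: (x k ^+ (m k - m0 k) * rest m).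
have tE : tail m0 i = x k ^+ m0 k * t.
  rewrite /tail /t mulr_sumr big_seq_cond [RHS]big_seq_cond.
  apply: eq_bigr => m /andP[mp Sm]; rewrite -scalerAr mulrA -exprD subnKC ?Sk //.
  congr (_ *: _); rewrite (bigD1 k) //=; congr (_ * _); apply: eq_bigl => j.
  by rewrite -val_eqE /=; lia.
have tP : t \in P i.+1.
  apply: subP => //; move: (IHi (ltnW iN)).
  by rewrite tE prime_idealrM (negPf (prime_expr _ (xnP k))).
have tailE : t = tail m0 i.+1 + \sum_(m <- msupp p | S m && (m k != m0 k))
    p@_m *: (x k ^+ (m k - m0 k) * rest m).
  rewrite /t (bigID (fun m : 'X_{1..N} => m k == m0 k)) /=; congr (_ + _).
  apply: eq_big => [m|m /andP[_ /eqP->]]; last by rewrite subnn mul1r.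
  apply/andP/forallP => [[/forallP Sm mk] j|Sm].
    apply/implyP; rewrite ltnS leq_eqVlt => /orP[/eqP jk|/(implyP (Sm j))//].
    by rewrite (_ : j = k) //; apply/val_inj.
  split; last by apply: (implyP (Sm k)) => /=.
  by apply/forallP => j; apply/implyP => ji; apply: (implyP (Sm j)); apply: ltnW.
rewrite -(addrK (\sum_(m <- msupp p | S m && (m k != m0 k))
    p@_m *: (x k ^+ (m k - m0 k) * rest m)) (tail m0 i.+1)) -tailE rpredB //.
rewrite big_seq_cond rpred_sum // => m /and3P[mp Sm mk].
apply: prime_scale; rewrite mulrC idealMr //.
have : (0 < m k - m0 k)%N by have := Sk m mp Sm; lia.
case: (m k - m0 k)%N => // e _; rewrite exprSr idealMr //; exact: (xP k).
Qed.

(** After all variables only the nonzero constant [p@_m0] remains, and it would lie in the prime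
    [P N]. *)
Lemma no_relation_chain : False.
Proof.
have [m1 m1p] : exists m, m \in msupp p.
  case E : (msupp p) => [|m l]; last by exists m; rewrite mem_head.
  by move: p0; rewrite (msuppnil0 E) eqxx.
have [m0 m0p minm0] := lexge_min_exists id m1p.
have := tail_in minm0 (leqnn N).
rewrite /tail -big_filter (_ : filter _ _ = [:: m0]).
  rewrite big_seq1 big_pred0 => [c1P|j]; last by apply/negbTE; rewrite -ltnNge.
  have := prime_scale (p@_m0)^-1 c1P; rewrite scalerA mulVf -?mcoeff_msupp //.
  by rewrite scale1r idealr1.
rewrite (eq_in_filter (a2 := pred1 m0)) ?filter_pred1_uniq //= => m mp.
apply/forallP/eqP => [h|-> j]; last by rewrite eqxx implybT.
by apply/mnmP => j; apply/eqP/(implyP (h j)).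
Qed.

End KrullUpperBound.

Section AlgebraicDependence.
Variables (K : fieldType) (d : nat) (y : 'I_d.+1 -> {mpoly K[d]}).

Lemma supp_in_mul a b (p q : {mpoly K[d]}) :
  supp_in (fun m => (mdeg m <= a)%N) p -> supp_in (fun m => (mdeg m <= b)%N) q ->
  supp_in (fun m => (mdeg m <= a + b)%N) (p * q).
Proof.
move=> pa qb m /msuppM_le /allpairsP[[m1 m2] /= [/pa m1a /qb m2b ->]].
by rewrite mdegD leq_add.
Qed.

Lemma supp_in_expr a (p : {mpoly K[d]}) k : supp_in (fun m => (mdeg m <= a)%N) p ->
  supp_in (fun m => (mdeg m <= a * k)%N) (p ^+ k).
Proof.
move=> pa; elim: k => [|k IHk]; last by rewrite exprS mulnS; apply: supp_in_mul.
by rewrite expr0 -mpolyX0; apply: supp_inX; rewrite mdeg0.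
Qed.

Lemma supp_in_prod (I : finType) (a : I -> nat) (F : I -> {mpoly K[d]}) :
  (forall i, supp_in (fun m => (mdeg m <= a i)%N) (F i)) ->
  supp_in (fun m => (mdeg m <= \sum_i a i)%N) (\prod_i F i).
Proof.
move=> h; elim/big_rec2: _ => [|i q b _]; last exact: supp_in_mul.
by rewrite -mpolyX0; apply: supp_inX; rewrite mdeg0.
Qed.

(* The N^(d+1) monomials in [y] with exponents below N lie in the span of the
   monomials with exponents at most D = (d+1) * N * e; for large N there are
   fewer of the latter. *)
Lemma algebraic_dependence : exists2 p : {mpoly K[d.+1]}, p != 0 & alg_eval y p = 0.
Proof.
(* [e] bounds all degrees. [N] is chosen so that [(D+1)^d <= N^d ((d+1)e+1)^d < N^(d+1)], using
   [D+1 <= N ((d+1)e+1)]. *)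
pose e := (\max_i msize (y i))%N; pose N := ((d.+1 * e).+1 ^ d).+1.
pose D := (d.+1 * (e * N))%N.
have ye i : supp_in (fun m => (mdeg m <= e)%N) (y i).
  move=> m /msize_mdeg_lt /ltnW h; apply: leq_trans h _.
  by rewrite /e (bigD1 i) //= leq_maxl.
pose rows := {ffun 'I_d.+1 -> 'I_N}; pose cols := {ffun 'I_d -> 'I_D.+1}.
pose rm (f : rows) : 'X_{1..d.+1} := [multinom f i : nat | i < d.+1].
pose cm (g : cols) : 'X_{1..d} := [multinom g i : nat | i < d].
pose yf (f : rows) : {mpoly K[d]} := \prod_i y i ^+ f i.
pose M : 'M[K]_(#|rows|, #|cols|) := \matrix_(i, j) (yf (enum_val i))@_(cm (enum_val j)).
have lt_card : (#|cols| < #|rows|)%N.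
  rewrite !card_ffun !card_ord.
  apply: leq_ltn_trans (_ : ((N * (d.+1 * e).+1) ^ d < _)%N).
    have mono a b k : (a <= b -> a ^ k <= b ^ k)%N by case: k => // k ab; rewrite leq_exp2r.
    by apply: mono; rewrite /D; nia.
  by rewrite expnMn expnSr ltn_pmul2l ?expn_gt0 //.
(* There are more rows than columns; a nonzero [v] in the left kernel supplies the coefficients of
   the relation. *)
have /rowV0Pn[v vker v0] : kermx M != 0.
  rewrite -mxrank_eq0 mxrank_ker -lt0n subn_gt0.
  exact: leq_ltn_trans (rank_leq_col _) lt_card.
have vM : v *m M = 0 by apply/sub_kermxP.
pose p : {mpoly K[d.+1]} := \sum_i v 0 i *: 'X_[rm (enum_val i)].
have rm_inj : injective rm.
  move=> f g /mnmP fg; apply/ffunP => i; apply/val_inj.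
  by have := fg i; rewrite !mnmE.
exists p.
  have [i vi] : exists i, v 0 i != 0.
    apply/existsP; apply: contraR v0 => /existsPn h; apply/eqP/rowP => i.
    by rewrite mxE; apply/eqP; rewrite -[_ == _]negbK; apply: h.
  apply: contraNneq vi => p0; have := congr1 (mcoeff (rm (enum_val i))) p0.
  rewrite mcoeff0 raddf_sum /= (bigD1 i) //= mcoeffZ mcoeffX eqxx mulr1 big1.
    by rewrite addr0 => ->.
  move=> j ji; rewrite mcoeffZ mcoeffX (inj_eq rm_inj) (inj_eq enum_val_inj).
  by rewrite (negPf ji) mulr0.
have -> : alg_eval y p = \sum_i v 0 i *: yf (enum_val i).
  rewrite linear_sum; apply: eq_bigr => i _; rewrite linearZ /= alg_evalXm.
  by congr (_ *: _); apply: eq_bigr => j _; rewrite mnmE.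
apply/mpolyP => m; rewrite mcoeff0 raddf_sum /=.
(* Coefficients above degree [D] vanish for degree reasons; the others are entries of [v *m M]. *)
have [mD|Dm] := leqP (mdeg m) D; last first.
  apply: big1 => i _; rewrite mcoeffZ memN_msupp_eq0 ?mulr0 //.
  apply/negP => /(supp_in_prod (fun j => supp_in_expr (ye j))).
  apply/negP; rewrite -ltnNge; apply: leq_ltn_trans Dm; rewrite /D.
  rewrite -big_distrr /= mulnCA leq_mul2l; apply/orP; right.
  apply: (@leq_trans (\sum_(j < d.+1) N)%N); last by rewrite sum_nat_const card_ord.
  by apply: leq_sum => j _; apply: ltnW.
have lt_m i : (m i < D.+1)%N.
  by rewrite ltnS (leq_trans _ mD) // mdegE (bigD1 i) //= leq_addr.
pose g : cols := [ffun i => Ordinal (lt_m i)].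
have cmg : cm g = m by apply/mnmP => i; rewrite mnmE ffunE.
have := congr1 (fun u : 'rV_ _ => u 0 (enum_rank g)) vM; rewrite mxE [RHS]mxE => vMg.
by rewrite -[RHS]vMg; apply: eq_bigr => i _; rewrite mcoeffZ mxE enum_rankK cmg.
Qed.

End AlgebraicDependence.

Lemma krull_dim_affine (K : fieldType) (Q : comAlgType K) (d : nat)
    (g : {lrmorphism Q -> {mpoly K[d]}}) : bijective g -> krull_dim Q d.
Proof.
move=> gbij; have ginj := bij_inj gbij; case: gbij => g' _ g'K e; split.
  case=> P chainP; rewrite leqNgt; apply/negP => de.
  have wit (i : 'I_d.+1) : exists x, x \in P i.+1 /\ x \notin P i.
    have [_ strict] := chainP i (leq_trans (ltn_ord i) de).
    apply/not_existsP => none; apply: strict => x xP.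
    by apply: contrapT => /negP xnP; apply: (none x).
  have [x xP] := choice wit.
  have [p p0 px] := algebraic_dependence (g \o x).
  apply: (@no_relation_chain K Q d.+1 x p P p0) => [|i ie|i|i].
  - by apply: ginj; rewrite lrmorph_alg_eval px rmorph0.
  - by case: (chainP i _); first exact: leq_trans ie de.
  - by case: (xP i).
  by case: (xP i).
(* The chain of coordinate subspaces: [ev i] kills the first [i] variables, and the variable of
   index [i] separates its kernel from the next one. *)
move=> ed; pose h i (j : 'I_d) : {mpoly K[d]} := if (j < i)%N then 0 else 'X_j.
pose ev i : {lrmorphism Q -> {mpoly K[d]}} := alg_eval (h i) \o g.
have memP i a : a \in prime_ker (ev i) <-> alg_eval (h i) (g a) = 0.
  by split=> [/eqP|a0]; last exact/eqP.
exists (fun i => prime_ker (ev i)) => i ie; split=> [a /memP a0|sub]; first apply/memP.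
  have -> : alg_eval (h i.+1) (g a) = alg_eval (h i.+1) (alg_eval (h i) (g a)).
    rewrite lrmorph_alg_eval; apply: eq_alg_eval => j /=.
    rewrite [h i j]/h; case: ltnP => ji; last by rewrite alg_evalX.
    by rewrite rmorph0 /h ltnS (ltnW ji).
  by rewrite a0 rmorph0.
have ied := leq_trans ie ed; pose k := Ordinal ied.
have /sub/memP : g' 'X_k \in prime_ker (ev i.+1).
  by apply/memP; rewrite g'K alg_evalX /h ltnSn.
rewrite g'K alg_evalX /h ltnn => /(congr1 (mcoeff U_(k)%MM)).
by rewrite mcoeffX eqxx mcoeff0 => /eqP; rewrite oner_eq0.
Qed.

(** * The comorphism of MG *)

Lemma map_border_reduce n (O : {fset 'X_{1..n}}) (B B' : comNzRingType)
    (f : {rmorphism B -> B'}) (c : O * border O -> B) (p : {mpoly B[n]}) :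
  map_mpoly f (border_reduce c p) = border_reduce (f \o c) (map_mpoly f p).
Proof.
(* The morphism may kill coefficients, so the right-hand sum is first spread over the support of
   [p]. *)
rewrite [RHS](@mlin_widen n B' _ _ (msupp p) (msupp_uniq p)); last first.
  move=> m; rewrite !mcoeff_msupp mcoeff_map_mpoly; apply: contra => /eqP->.
  by apply/eqP; apply: raddf0.
rewrite rmorph_sum; apply: eq_bigr => m _; rewrite /= map_mpolyZ mcoeff_map_mpoly.
congr (_ *: _); case: insub => [b|]; last by rewrite map_mpolyX.
by rewrite rmorph_sum; apply: eq_bigr => t _; rewrite /= map_mpolyZ map_mpolyX.
Qed.

Lemma map_border_poly n (O : {fset 'X_{1..n}}) (B B' : comNzRingType)
    (f : {rmorphism B -> B'}) (c : O * border O -> B) (b : border O) :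
  map_mpoly f (border_poly c b) = border_poly (f \o c) b.
Proof.
rewrite /border_poly rmorphB /= map_mpolyX rmorph_sum; congr (_ - _).
by apply: eq_bigr => t _; rewrite /= map_mpolyZ map_mpolyX.
Qed.

Lemma eq_border_poly n (O : {fset 'X_{1..n}}) (B : comNzRingType)
    (c c' : O * border O -> B) (b : border O) :
  c =1 c' -> border_poly c b = border_poly c' b.
Proof. by move=> cc'; congr (_ - _); apply: eq_bigr => t _; rewrite cc'. Qed.

Lemma mpoly_fsetE n (B : comNzRingType) (O : {fset 'X_{1..n}}) (p : {mpoly B[n]}) :
  supp_in (mem O) p -> p = \sum_(t : O) p@_(val t) *: 'X_[val t].
Proof.
move=> pO; apply/mpolyP => m; rewrite raddf_sum /=.
have [mO|mO] := boolP (m \in O); last first.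
  rewrite memN_msupp_eq0 ?big1 //; last by apply: contra mO => /pO.
  move=> t _; rewrite mcoeffZ mcoeffX (_ : val t == m = false) ?mulr0 //.
  by apply: contraNF mO => /eqP <-; apply: valP.
rewrite (bigD1 [` mO]) //= mcoeffZ mcoeffX eqxx mulr1 big1 ?addr0 // => t tm.
rewrite mcoeffZ mcoeffX (_ : val t == m = false) ?mulr0 //.
by apply: contraNF tm => /eqP tm; apply/eqP/val_inj.
Qed.

Section Comorphism.
Variables (K : fieldType) (n' r s : nat) (W : nat -> 'X_{1..n'.+1}).
Hypothesis hW : admissible r s W.
Local Notation n := n'.+1.
Local Notation O := (order_ideal r s W).
Local Notation A := (KCTheta r s W K).
Local Notation Y := (Ypoly (@Cvar n r s W K)).
Local Notation tau := (@target n r s W K).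
Local Notation NFX := (@NFX K n' r s W).
Local Notation NF := (mlin NFX).
Local Notation MG := (@MG n r s W K).

(** The sign follows the convention [b - \sum_t z_(t,b) t]; these are the coefficients of the normal
    form of the border monomial. *)
Definition MG_coeff (tb : O * border O) : A :=
  - (Y (val tb.2) + tau (val tb.2))@_(val tb.1).

Lemma border_notO (b : border O) : val b \notin O.
Proof. by have /mem_border[] := valP b. Qed.

Lemma MG_tail (b : border O) :
  \sum_(t : O) MG_coeff (t, b) *: 'X_[val t] = NFX (val b).
Proof.
have bO := border_notO b.
rewrite NFX_nonO // [in RHS](@mpoly_fsetE n A O (_ + _)); last first.
  by apply: supp_inD; [apply: supp_YO|apply: (supp_targetO hW)].
by rewrite -sumrN; apply: eq_bigr => t _; rewrite scaleNr.
Qed.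

Lemma MG_border_poly b : MG b = border_poly MG_coeff b.
Proof.
by rewrite /border_poly MG_tail NFX_nonO ?border_notO // opprK addrA.
Qed.

Lemma MG_NF b : MG b = 'X_[val b] - NF 'X_[val b].
Proof. by rewrite MG_border_poly /border_poly MG_tail mlinX. Qed.

Lemma NF_mul_MG (k : option 'I_n) b : NF ('X_[xmon k] * MG b) = 0.
Proof.
rewrite MG_NF mulrBr linearB /=; case: k => [j|] /=.
  by rewrite (NF_mulX hW) subrr.
by rewrite mpolyX0 !mul1r (NF_idem hW) subrr.
Qed.

(** On [O] and its border a single replacement already gives the normal form, by [MG_tail]. *)
Lemma border_reduce_NF p : supp_in (mem (O `|` border O)) p ->
  border_reduce MG_coeff p = NF p.
Proof.
move=> hp; apply: eq_mlin_supp => m /hp /=; rewrite in_fsetU.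
case: insubP => [b mb <- _|mb]; first exact: MG_tail.
by rewrite (negPf mb) orbF => mO; rewrite NFX_O.
Qed.

Lemma mul_xmon_border (k : option 'I_n) m : m \in O -> (xmon k + m)%MM \in O `|` border O.
Proof.
move=> mO; rewrite in_fsetU; case: k => [k|]; last by rewrite add0m mO.
have [//|kmO] := boolP ((xmon (Some k) + m)%MM \in O).
by apply/mem_border; split=> //; exists k; exists m.
Qed.

Local Notation Kc := (polyring K (O * border O)).

Definition MG_eval : Kc -> A := alg_eval (fun i => MG_coeff (enum_val i)).

HB.instance Definition _ := GRing.LRMorphism.copy MG_eval
  (alg_eval (fun i => MG_coeff (enum_val i))).

Lemma MG_eval_pvar tb : MG_eval (pvar K tb) = MG_coeff tb.
Proof. by rewrite /MG_eval alg_evalX enum_rankK. Qed.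

Lemma MG_eval_generator p : bb_generator p -> MG_eval p = 0.
Proof.
case=> k [l] [b] [b'] [m] [_ kl ->].
have U c : map_mpoly MG_eval (universal_poly K c) = MG c.
  rewrite map_border_poly MG_border_poly; apply: eq_border_poly => tb.
  exact: MG_eval_pvar.
have SE : map_mpoly MG_eval (S_poly K k l b b') =
    'X_[xmon k] * MG b - 'X_[xmon l] * MG b'.
  rewrite /S_poly.
  move: (U b) (U b') => /=.
  move: (universal_poly K b) (universal_poly K b') => u u' Uu Uu'.
  by rewrite rmorphB !rmorphM /= Uu Uu' !map_mpolyX.
rewrite -mcoeff_map_mpoly map_border_reduce SE.
have -> : border_reduce (MG_eval \o @pvar K (O * border O)%type) =
    border_reduce MG_coeff.
  by congr border_reduce; apply/funext => tb; apply: MG_eval_pvar.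
rewrite border_reduce_NF; first by rewrite linearB /= !NF_mul_MG subrr mcoeff0.
(* The two equal leading products cancel; what remains are multiples by [x_k] or [x_l] of elements
   of [O], hence monomials of [O] or its border. *)
rewrite !MG_NF !mulrBr -!mpolyXD kl opprB addrC addrA subrK !mlinX.
have tl c k' : supp_in (mem (O `|` border O)) ('X_[xmon k'] * NFX (val c)).
  by apply: supp_inXM (@supp_NFXO K n' r s W hW (val c)) _ => x; apply: mul_xmon_border.
by apply: supp_inD; [apply: tl|apply: supp_inN; apply: tl].
Qed.

Lemma MG_eval_bb_ideal a : a \in bb_ideal O K -> MG_eval a = 0.
Proof.
move=> /asboolP [l [lS ->]]; rewrite rmorph_sum big_seq big1 // => q /lS qS.
by rewrite rmorphM /= (MG_eval_generator qS) mulr0.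
Qed.

Definition xi_MG : {lrmorphism bb_ring O K -> A} := quot_lift MG_eval_bb_ideal.

Lemma xi_MG_coord tb : xi_MG (bb_coord K tb) = MG_coeff tb.
Proof. by rewrite -MG_eval_pvar; apply: (quot_lift_pi MG_eval_bb_ideal). Qed.

Lemma xi_MG_induced : induced_comorphism xi_MG MG.
Proof.
move=> b; rewrite MG_border_poly; apply: eq_border_poly => tb.
by rewrite -xi_MG_coord.
Qed.

End Comorphism.

Lemma alg_eval_pvar (K : fieldType) (I : finType) (p : polyring K I) :
  p = alg_eval (fun i => pvar K (enum_val i)) p.
Proof.
rewrite alg_evalE {1}[p]mpolyE; apply: eq_bigr => m _; congr (_ *: _).
rewrite [LHS]mpolyXE_id; apply: eq_bigr => i _.
by rewrite /pvar enum_valK.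
Qed.

Lemma alg_surj_pvar (K : fieldType) (I : finType) (B : comAlgType K) (f : {lrmorphism B -> polyring K I}) :
  (forall i, exists x, f x = pvar K i) -> forall p, exists x, f x = p.
Proof.
move=> h p; have [x xE] := choice h.
exists (alg_eval (fun i => x (enum_val i)) p).
by rewrite lrmorph_alg_eval [RHS]alg_eval_pvar; apply: eq_alg_eval => i /=.
Qed.

(** * Surjectivity of the comorphism *)

Section Surjectivity.
Variables (K : fieldType) (n' r s : nat) (W : nat -> 'X_{1..n'.+1}).
Hypothesis hW : admissible r s W.
Local Notation n := n'.+1.
Local Notation O := (order_ideal r s W).
Local Notation A := (KCTheta r s W K).
Local Notation chi := (key_monomial r s W).
Local Notation mhat := (key_cofactor r s W).
Local Notation Y := (Ypoly (@Cvar n r s W K)).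
Local Notation tau := (@target n r s W K).
Local Notation sig := (@sigma n r s W K).
Local Notation NFX := (@NFX K n' r s W).
Local Notation NF := (mlin NFX).
Local Notation xi := (xi_MG K hW).
Implicit Types (p q : {mpoly A[n]}).

Definition in_image (a : A) : Prop := exists x, xi x = a.

Lemma in_image0 : in_image 0.
Proof. by exists 0; apply: rmorph0. Qed.

Lemma in_image1 : in_image 1.
Proof. by exists 1; apply: rmorph1. Qed.

Lemma in_imageD a b : in_image a -> in_image b -> in_image (a + b).
Proof. by move=> [x <-] [y <-]; exists (x + y); apply: rmorphD. Qed.

Lemma in_imageN a : in_image a -> in_image (- a).
Proof. by move=> [x <-]; exists (- x); apply: rmorphN. Qed.

Lemma in_imageM a b : in_image a -> in_image b -> in_image (a * b).
Proof. by move=> [x <-] [y <-]; exists (x * y); apply: rmorphM. Qed.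

Definition coeffs_in_image p : Prop := forall m, in_image p@_m.

Lemma coeffs_in_image0 : coeffs_in_image 0.
Proof. by move=> m; rewrite mcoeff0; apply: in_image0. Qed.

Lemma coeffs_in_imageD p q :
  coeffs_in_image p -> coeffs_in_image q -> coeffs_in_image (p + q).
Proof. by move=> hp hq m; rewrite mcoeffD; apply: in_imageD. Qed.

Lemma coeffs_in_imageN p : coeffs_in_image p -> coeffs_in_image (- p).
Proof. by move=> hp m; rewrite mcoeffN; apply: in_imageN. Qed.

Lemma coeffs_in_imageX m : coeffs_in_image 'X_[m].
Proof.
by move=> m'; rewrite mcoeffX; case: eqP => _; [apply: in_image1|apply: in_image0].
Qed.

Lemma coeffs_in_imageZ a p : in_image a -> coeffs_in_image p -> coeffs_in_image (a *: p).
Proof. by move=> ha hp m; rewrite mcoeffZ; apply: in_imageM. Qed.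

Lemma coeffs_in_image_sum (I : Type) (L : seq I) (P : pred I) (F : I -> {mpoly A[n]}) :
  (forall i, P i -> coeffs_in_image (F i)) -> coeffs_in_image (\sum_(i <- L | P i) F i).
Proof.
move=> h; apply: big_ind => //; first exact: coeffs_in_image0.
exact: coeffs_in_imageD.
Qed.

Lemma coeffs_in_image_mlin phi p : coeffs_in_image p ->
  (forall m, m \in msupp p -> coeffs_in_image (phi m)) -> coeffs_in_image (mlin phi p).
Proof.
move=> hp h; rewrite /mlin big_seq; apply: coeffs_in_image_sum => m mp.
exact: (coeffs_in_imageZ (hp m) (h m mp)).
Qed.

Lemma coeffs_in_imageXM u p : coeffs_in_image p -> coeffs_in_image ('X_[u] * p).
Proof.
move=> hp; have -> : 'X_[u] * p = mlin (fun m => 'X_[(u + m)%MM]) p.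
  rewrite {1}[p]mpolyE mulr_sumr; apply: eq_bigr => m _.
  by rewrite -scalerAr -mpolyXD.
by apply: coeffs_in_image_mlin => // m _; apply: coeffs_in_imageX.
Qed.

Lemma LM_border b : b \in LM r s W -> b \in border O.
Proof.
case/(mem_LM hW) => bO _ hb; apply/mem_border; split=> //.
have [k /eqP/lvP[bk _]] := lv_of_nonO hW bO.
by exists k; exists (b - U_(k))%MM; rewrite hb // subU_add.
Qed.

Lemma border_coeffs_in_image b : b \in border O -> coeffs_in_image (Y b + tau b).
Proof.
move=> bB m; have [mO|mO] := boolP (m \in O); last first.
  rewrite memN_msupp_eq0; first exact: in_image0.
  apply: contra mO; apply: supp_inD; [exact: supp_YO|exact: supp_targetO].
rewrite -[_@__]opprK; apply: in_imageN.
by exists (bb_coord K ([` mO], [` bB])); rewrite xi_MG_coord.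
Qed.

Lemma key_spec k : key r s W k -> chi k \in LM r s W /\ lv (chi k) = Some k.
Proof.
case/existsP => m /eqP lvm.
have [] : val m \notin O /\ (mdeg (val m) <= s)%N; last first.
  by move=> mO ms; have [] := key_monomial_spec hW mO ms lvm.
have : val m \in nonO_le r s W by apply: valP.
have -> : (val m \in nonO_le r s W) = (val m \in nonO r s W) && (mdeg (val m) <= s)%N.
  by rewrite in_fset inE.
by rewrite (mem_nonO hW) => /andP[/andP[]].
Qed.

Lemma sigma_coeff (kq : Theta r s W) : (sig (val kq).1)@_(val kq).2 = Tvar K kq.
Proof.
rewrite /sigma raddf_sum /= (bigD1 kq) //= mcoeffZ mcoeffX eqxx mulr1.
rewrite big1 ?addr0 // => kq' /andP[/eqP e1 neq]; rewrite mcoeffZ mcoeffX.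
case: eqP => e2; last by rewrite mulr0.
by case/eqP: neq; apply: val_inj; rewrite [LHS]surjective_pairing e1 e2 -surjective_pairing.
Qed.

(** The cofactor of [x_k^(e_k)] in [chi_k] is [mhat_k], and by definition of the seeds every product
    of [mhat_k] with one of them lies in [O], so nothing is reduced. *)
Lemma target_key k : key r s W k -> tau (chi k) = 'X_[mhat k] * sig k.
Proof.
move=> kk; have [cLM lvc] := key_spec kk; have [cO cs _] := mem_LM hW _ cLM.
rewrite (target_raw K hW cO cs lvc) -[RHS]mlin_id; apply: eq_mlin_supp => m.
rewrite /raw_target mulrC (perm_mem (msuppMX _ _)) => /mapP[u /supp_sigma us ->].
by rewrite NFX_O // addmC; case: (mem_seeds hW cLM us).
Qed.

(** The indeterminate is the coefficient of [mhat_k u] in the tail at [chi_k]. [Y] does not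
    interfere, as its terms have degree [s] while [mhat_k u] has smaller degree. *)
Lemma Tvar_in_image kq : in_image (Tvar K kq).
Proof.
have := valP kq; case E: (val kq) => [k u]; rewrite mem_Theta => /andP[kk us].
have [cLM lvc] := key_spec kk; have [uO _ us'] := mem_seeds hW cLM us.
have := border_coeffs_in_image (LM_border cLM) (mhat k + u)%MM.
rewrite mcoeffD memN_msupp_eq0 ?add0r; last first.
  by apply/negP => /supp_Ypoly /TM_deg ms; move: us'; rewrite addmC ms ltnn.
rewrite target_key // mulrC mcoeffMX.
by have := sigma_coeff kq; rewrite E => ->.
Qed.

Lemma initial_target_in_image m : coeffs_in_image (initial_target r s W K m).
Proof.
rewrite /initial_target; case: ifP => _; last exact: coeffs_in_image0.
case: lv => [k|]; last exact: coeffs_in_image0.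
rewrite trunc_mlin; apply: coeffs_in_image_mlin => [|w _].
  apply/coeffs_in_imageXM/coeffs_in_image_sum => kq _.
  by apply: coeffs_in_imageZ; [apply: Tvar_in_image|apply: coeffs_in_imageX].
by case: ifP => _; [apply: coeffs_in_imageX|apply: coeffs_in_image0].
Qed.

(** Backward induction: [tau m] is built from the theta indeterminates and later [Y] and [tau]. For
    [m] in [LM], a border monomial, [Y m + tau m] is known, so [Y m] follows by subtraction. *)
Lemma NFX_in_image m : m \notin O -> (mdeg m <= s)%N ->
  coeffs_in_image (Y m) /\ coeffs_in_image (tau m).
Proof.
move=> mO ms; move: m ms mO; apply: listed_ind => m ms IHm mO.
have ht : coeffs_in_image (tau m).
  rewrite (targetE K hW mO); apply: coeffs_in_image_mlin.
    exact: initial_target_in_image.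
  move=> w /(supp_initial_target hW mO) mw.
  have [wO|wO] := boolP (w \in O); first by rewrite NFX_O //; apply: coeffs_in_imageX.
  have [ws|ws] := leqP (mdeg w) s; last first.
    by rewrite (NFX_high K hW ws); apply: coeffs_in_image0.
  have [hY ht] := IHm w ws mw wO.
  by rewrite NFX_nonO //; apply/coeffs_in_imageN/coeffs_in_imageD.
split=> //; have [mL|mL] := boolP (m \in LM r s W); last first.
  by rewrite Ypoly_notLM //; apply: coeffs_in_image0.
rewrite -[Y m](addrK (tau m)); apply: coeffs_in_imageD.
  exact: border_coeffs_in_image (LM_border mL).
exact: coeffs_in_imageN.
Qed.

Lemma Cvar_in_image ij : in_image (Cvar K ij).
Proof.
case: ij => t b; have [bO bs _] := mem_LM hW _ (valP b).
have [/(_ (val t)) hY _] := NFX_in_image bO bs.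
suff -> : Cvar K (t, b) = - (Y (val b))@_(val t) by apply: in_imageN.
rewrite Ypoly_LM mcoeffN opprK raddf_sum /= (bigD1 t) //= mcoeffZ mcoeffX eqxx mulr1.
rewrite big1 ?addr0 // => t' neq; rewrite mcoeffZ mcoeffX.
by rewrite (inj_eq val_inj) (negPf neq) mulr0.
Qed.

Lemma xi_MG_surj a : exists x, xi x = a.
Proof.
by apply: alg_surj_pvar => -[ij|kq]; [apply: Cvar_in_image|apply: Tvar_in_image].
Qed.

(** [Y] lives in degree [s] and the target only in monomials listed after [b], so no degree
    drops. *)
Lemma MG_coeff_low (t : O) (b : border O) : (mdeg (val t) < mdeg (val b))%N ->
  MG_coeff K (t, b) = 0.
Proof.
move=> /= tb; rewrite /MG_coeff memN_msupp_eq0 ?oppr0 //=; apply/negP.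
move/msuppD_le; rewrite mem_cat => /orP[tY|].
  have := TM_deg (supp_Ypoly tY); have [bL|bL] := boolP (val b \in LM r s W).
    by have /= := LM_deg hW bL; lia.
  by move: tY; rewrite Ypoly_notLM // msupp0.
by move/(supp_target_after hW (border_notO b))/listed_before_deg => /=; lia.
Qed.

End Surjectivity.

(** * Ideals supported at the origin *)

Section Support.
Variables (K : fieldType) (n' r s : nat) (W : nat -> 'X_{1..n'.+1}).
Hypothesis hW : admissible r s W.
Local Notation n := n'.+1.
Local Notation O := (order_ideal r s W).

Lemma mcoeff0_meval (h : {mpoly K[n]}) : h.@[fun=> 0] = h@_0%MM.
Proof.
rewrite {1}[h]mpolyE rmorph_sum /=.
have zero m : ('X_[m] : {mpoly K[n]}).@[fun=> 0] = (m == 0%MM)%:R.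
  rewrite mevalX; case: eqVneq => [->|m0].
    by rewrite big1 // => i _; rewrite mnm0E expr0.
  have /lv_exists[k /eqP/lvP[mk _]] : (0 < mdeg m)%N by rewrite lt0n mdeg_eq0.
  by rewrite (bigD1 k) //= expr0n eqn0Ngt mk mul0r.
under eq_bigr => m _ do rewrite mevalZ zero.
rewrite [in RHS](mpolyE h) raddf_sum /=; apply: eq_bigr => m _.
by rewrite mcoeffZ mcoeffX.
Qed.

Lemma border_basis_support (c : O * border O -> K) :
  (forall (t : O) (b : border O), (mdeg (val t) < mdeg (val b))%N -> c (t, b) = 0) ->
  supported_at_origin (ideal_gen (fun h => exists b, h = border_poly c b)).
Proof.
move=> c_low P; split=> [sub|PE h [l [lS ->]]]; last first.
  rewrite PE rmorph_sum big_seq big1 // => q /lS [b qE].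
  (* Generators vanish at the origin: a constant term could only come from [t = 1], whose degree is
     below that of [b]. *)
  rewrite rmorphM /= qE /border_poly rmorphB rmorph_sum /= mevalX.
  have bO : val b \notin O by apply: (border_notO b).
  have /lv_exists[k /eqP/lvP[bk _]] : (0 < mdeg (val b))%N.
    exact: ltnW (nonO_deg hW bO).
  rewrite (bigD1 k) //= expr0n eqn0Ngt bk mul0r sub0r big1 ?oppr0 ?mulr0 // => t _.
  rewrite mevalZ mcoeff0_meval mcoeffX; case: eqP => [t0|]; last by rewrite mulr0.
  by rewrite c_low ?mul0r //= t0 mdeg0; apply: ltnW (nonO_deg hW bO).
have PX (m : 'X_{1..n}) k : (0 < m k)%N -> 'X_k \in P -> 'X_[m] \in P.
  move=> mk kP; rewrite -(subU_add mk) mpolyXD mulrC idealMr //.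
have varP (k : 'I_n) : 'X_k \in P.
  (* Induction from [x_n] towards [x_1]. *)
  have [d] := ubnP (n - k)%N; elim: d k => [//|d IHd] k kd.
  have ex : exists e, (U_(k) *+ e)%MM \notin O.
    by exists s.+1; apply/negP => /(order_ideal_deg hW); rewrite mdegMn mdeg1 mul1n ltnn.
  case: (ex_minnP ex) => e eO mine.
  have e0 : (0 < e)%N.
    by have := nonO_deg hW eO; rewrite mdegMn mdeg1; lia.
  have eB : (U_(k) *+ e)%MM \in border O.
    apply/mem_border; split=> //; exists k; exists (U_(k) *+ e.-1)%MM.
    rewrite -mulmS prednK //; split=> //.
    by rewrite -[_ \in _]negbK; apply/negP => /mine; lia.
  have expP : 'X_k ^+ e \in P.
    rewrite mpolyXn -(subrK (\sum_(t : O) c (t, [` eB]) *: 'X_[val t]) 'X_[_]).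
    rewrite rpredD //.
      apply: sub; exists [:: (1, border_poly c [` eB])]; split.
        by move=> q; rewrite inE => /eqP->; exists [` eB].
      by rewrite big_seq1 mul1r.
    rewrite rpred_sum // => t _.
    have [te|et] := ltnP (mdeg (val t)) e.
      by rewrite c_low ?scale0r ?rpred0 //= mdegMn mdeg1 mul1n.
    apply: prime_scale.
    have [/existsP[l /andP[kl tl]]|/existsPn none] :=
        boolP [exists l : 'I_n, (k < l)%N && (0 < val t l)%N].
      by apply: PX tl _; apply: IHd; have := ltn_ord l; lia.
    (* Without variables beyond [x_k], [t] is lex at least [x_k^(deg t)], a multiple of [x_k^e] and
       so outside [O]; this contradicts [t] being in [O]. *)
    have tO : val t \in O by apply: valP.
    have [] := negP _ tO.
    have kO : (U_(k) *+ mdeg (val t))%MM \notin O.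
      have -> : (U_(k) *+ mdeg (val t) = U_(k) *+ e + U_(k) *+ (mdeg (val t) - e))%MM.
        by apply/mnmP => j; rewrite mnmDE !mulmnE -mulnDr subnKC.
      exact: nonO_mul.
    apply: (nonO_lex hW kO); first by rewrite mdegMn mdeg1 mul1n.
    apply: lexge_pure_power => j kj; have := none j; rewrite kj /=; lia.
  by apply: contraLR expP => kP; apply: prime_expr.
move=> h; rewrite mcoeff0_meval.
(* With all variables in [P], membership depends only on the constant term, and [P] contains no
   nonzero constant. *)
have tailP : h - (h@_0%MM)%:MP \in P.
  rewrite [_ - _]mpolyE big_seq rpred_sum // => m mh; apply: prime_scale.
  have m0 : m != 0%MM.
    by apply: contraTneq mh => ->; rewrite mcoeff_msupp mcoeffB mcoeffC eqxx mulr1 subrr eqxx.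
  have /lv_exists[k /eqP/lvP[mk _]] : (0 < mdeg m)%N by rewrite lt0n mdeg_eq0.
  exact: PX mk (varP k).
move: tailP; set c0 := h@_0%MM => tailP.
rewrite -{1}(subrK c0%:MP h) rpredDl //.
apply/idP/eqP => [cP|->]; last by rewrite mpolyC0 rpred0.
apply/eqP; rewrite -[_ == _]negbK; apply/negP => c0n.
have := prime_scale c0^-1 cP; rewrite -mul_mpolyC -mpolyCM mulVf //.
by rewrite mpolyC1 idealr1.
Qed.

End Support.

Lemma map_mlin_eq0 n (B B' : comNzRingType) (f : {rmorphism B -> B'}) phi
    (p : {mpoly B[n]}) : map_mpoly f p = 0 -> map_mpoly f (mlin phi p) = 0.
Proof.
move=> p0; rewrite rmorph_sum big1 // => m _.
by rewrite /= map_mpolyZ -mcoeff_map_mpoly p0 mcoeff0 scale0r.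
Qed.

(** * Specialization of the theta indeterminates to zero *)

Section DistinguishedLocus.
Variables (K : fieldType) (n' r s : nat) (W : nat -> 'X_{1..n'.+1}).
Hypothesis hW : admissible r s W.
Local Notation n := n'.+1.
Local Notation O := (order_ideal r s W).
Local Notation A := (KCTheta r s W K).
Local Notation AC := (KC r s W K).

Section Specialization.
Variable ev : {lrmorphism A -> AC}.
Hypothesis evC : forall ij, ev (Cvar K ij) = pvar K ij.
Hypothesis evT : forall kq, ev (Tvar K kq) = 0.

(** Every [sigma] specializes to 0, and truncation and reduction only recombine coefficients that
    are already killed. *)
Lemma specialize_target m : map_mpoly ev (@target n r s W K m) = 0.
Proof.
have [mO|mO] := boolP (m \in O).
  by rewrite target_notN ?mem_nonO // ?mO // rmorph0.
rewrite (targetE K hW mO); apply: map_mlin_eq0.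
rewrite /initial_target; case: ifP => _; last exact: rmorph0.
case: lv => [k|]; last exact: rmorph0.
rewrite trunc_mlin; apply: map_mlin_eq0; rewrite rmorphM /=.
rewrite [X in _ * X](_ : _ = 0) ?mulr0 // rmorph_sum big1 // => kq _.
by rewrite /= map_mpolyZ /= evT scale0r.
Qed.

Lemma specialize_Y (m : 'X_{1..n}) : map_mpoly ev (Ypoly (@Cvar n r s W K) m) =
  @Ypoly n r s W AC (@pvar K (C_index r s W)) m.
Proof.
rewrite /Ypoly; case: insub => [b|]; last exact: rmorph0.
rewrite rmorphN rmorph_sum; congr (- _); apply: eq_bigr => t _.
by rewrite /= map_mpolyZ map_mpolyX /= evC.
Qed.

Lemma specialize_MG b : map_mpoly ev (@MG n r s W K b) = @G n r s W K b.
Proof.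
by rewrite /MG !rmorphD /= specialize_target addr0 specialize_Y map_mpolyX.
Qed.

Lemma specialize_induced : induced_comorphism (ev \o xi_MG K hW) (@G n r s W K).
Proof.
by move=> b; rewrite -specialize_MG (xi_MG_induced K hW b) map_border_poly.
Qed.

Lemma specialize_surj a : exists x, ev x = a.
Proof. by apply: alg_surj_pvar => ij; exists (Cvar K ij). Qed.

End Specialization.

Lemma kill_Theta_exists : exists ev : {lrmorphism A -> AC},
  (forall ij, ev (Cvar K ij) = pvar K ij) /\ (forall kq, ev (Tvar K kq) = 0).
Proof.
exists (alg_eval (fun i : 'I_#|CTheta_index r s W| =>
  if enum_val i is inl ij then pvar K ij else 0 : AC)).
by split=> i; apply: etrans (alg_evalX _ _) _; rewrite enum_rankK.
Qed.

End DistinguishedLocus.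

(** * Affine-space structure of the coordinate rings, and assembly of the result *)

Lemma ker_quotient_affine_space (K : fieldType) (A B : comAlgType K) (d : nat)
    (I : idealr A) (f : {lrmorphism A -> B}) : (forall a, (a \in I) = (f a == 0)) ->
  (forall b, exists a, f a = b) ->
  is_affine_space B d -> is_affine_space {ideal_quot I} d.
Proof.
move=> If /(ker_quotient_iso If)[g gbij] [h hbij].
by exists (h \o g); apply: bij_comp.
Qed.

Lemma quotient_krull_dim (K : fieldType) (A : comAlgType K) (I : idealr A) (d : nat) :
  is_affine_space {ideal_quot I} d -> krull_dim {ideal_quot I} d.
Proof. by case=> g gbij; apply: krull_dim_affine gbij. Qed.

Lemma KC_affine_space (K : fieldType) n r s (W : nat -> 'X_{1..n}) :
  is_affine_space (KC r s W K) #|C_index r s W|.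
Proof.
exists (alg_eval (fun i => 'X_i)); exists id => p; apply: etrans (esym (alg_eval_pvar p)).
  by apply: eq_alg_eval => i; rewrite /pvar enum_valK.
by apply: eq_alg_eval => i; rewrite /pvar enum_valK.
Qed.

Lemma KCTheta_affine_space (K : fieldType) n r s (W : nat -> 'X_{1..n}) :
  is_affine_space (KCTheta r s W K) (#|{: C_index r s W}| + #|{: Theta r s W}|)%N.
Proof.
rewrite -card_sum.
exists (alg_eval (fun i => 'X_i)); exists id => p; apply: etrans (esym (alg_eval_pvar p)).
  by apply: eq_alg_eval => i; rewrite /pvar enum_valK.
by apply: eq_alg_eval => i; rewrite /pvar enum_valK.
Qed.

Lemma admissible_nvars r s (W : nat -> 'X_{1..0}) : ~ admissible r s W.
Proof.
case=> [[_ rs]] /(_ s.+1) degW _ _ _.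
have : mdeg (W s.+1) = s.+1 by apply: degW; lia.
by rewrite mdegE big_ord0.
Qed.

Theorem corollary4 (K : closedFieldType) (charK0 : [pchar K] =i pred0)
    (n r s : nat) (W : nat -> 'X_{1..n}) (hW : admissible r s W) :
  let O := order_ideal r s W in
  exists (xiMG : {lrmorphism bb_ring O K -> KCTheta r s W K})
         (xiG : {lrmorphism bb_ring O K -> KC r s W K}),
  [/\ induced_comorphism xiMG (@MG n r s W K),
      induced_comorphism xiG (@G n r s W K) &
  let Xtilde := ker_ideal xiMG in
  let XO := ker_ideal xiG in
  [/\ (forall P : prime_idealr (bb_ring O K),
         spec_image xiMG P <-> zero_locus Xtilde P),
      irreducible_subset (zero_locus Xtilde),
      is_affine_space {ideal_quot Xtilde}
        (#|{: C_index r s W}| + #|{: Theta r s W}|)%N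
      /\ (#|{: C_index r s W}| + #|{: Theta r s W}|
           = #|{: LM r s W}| * #|{: TM r s W}| + #|{: Theta r s W}|)%N,
      subscheme XO Xtilde
      /\ krull_dim {ideal_quot XO} #|{: C_index r s W}|
    & forall p : {lrmorphism bb_ring O K -> K^o},
        {subset Xtilde <= ker_ideal p} ->
        supported_at_origin (point_ideal p)]].
Proof.
case: n W hW => [|n'] W hW O; first by case: (admissible_nvars hW).
have [ev [evC evT]] := kill_Theta_exists K r s W.
have : exists xi : {lrmorphism bb_ring O K -> KC r s W K},
    induced_comorphism xi (@G n'.+1 r s W K) /\ forall a, xi a = ev (xi_MG K hW a).
  by exists (ev \o xi_MG K hW); split=> //; apply: specialize_induced.
have := xi_MG_coord K hW; have := @xi_MG_surj K _ _ _ _ hW; have := xi_MG_induced K hW.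
(* Unification loops if it can unfold [xi_MG]. *)
move: (xi_MG K hW) => xiMG MGind MGsurj MGcoord [xiG [Gind GE]].
exists xiMG, xiG; split=> //.
move=> Xtilde XO; split.
- by move=> P; apply: spec_image_surj; apply: MGsurj.
- exact: zero_locus_ker_irreducible.
- split; last by rewrite card_prod mulnC.
  have XE a : (a \in Xtilde) = (xiMG a == 0) by [].
  move: (Xtilde) XE => I IE.
  have := ker_quotient_affine_space IE MGsurj (KCTheta_affine_space K r s W).
  (* The two sides differ by [reverse_coercion]s, over which unification loops. *)
  by rewrite /reverse_coercion.
- split.
    (* [xiG] factors through [xiMG], so its kernel is the larger one. *)
    move=> a /eqP a0; apply/eqP; apply: etrans (GE a) _.
    exact: etrans (congr1 ev a0) (rmorph0 ev).
  have Gsurj a : exists x, xiG x = a.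
    have [b <-] := specialize_surj evC a; have [x <-] := MGsurj b.
    by exists x.
  have XE a : (a \in XO) = (xiG a == 0) by [].
  move: (XO) XE => I IE.
  have := quotient_krull_dim (ker_quotient_affine_space IE Gsurj (KC_affine_space K r s W)).
  by rewrite /reverse_coercion.
(* Coordinates with [deg t < deg b] lie in the kernel of [xiMG], hence vanish at the point [p]. *)
move=> p sub; apply: (border_basis_support hW) => t b tb.
apply/eqP/sub/eqP; apply: etrans (MGcoord _) _.
exact: MG_coeff_low.
Qed.
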